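(* Let $\Theta$ be an orthosymmetric subset of the space of real sequences $\theta=(\theta_1,\theta_2,\dots)$, and consider the Gaussian sequence model $Y_i=\theta_i+n^{-1/2}z_i$, $i=1,2,\dots$, with $z_i$ i.i.d. $N(0,1)$. Let $\hat Q=\sum_i a_iY_i^2+c$ be any diagonal quadratic estimator of $Q(\theta)=\sum_{i}\theta_i^2$. Then $$\sup_{\theta\in\Theta}E_\theta(\hat Q-Q(\theta))^2=\sup_{\theta\in \mathrm{Q.Hull}(\Theta)}E_\theta(\hat Q-Q(\theta))^2 .$$ Consequently $$R_Q^*(n;\Theta)=R_Q^*(n;\mathrm{Q.Hull}(\Theta))=R_{DQ}^*(n;\mathrm{Q.Hull}(\Theta)).$$
   Context: A set $\Theta$ of sequences is orthosymmetric if $\theta\in\Theta$ implies $(\pm\theta_1,\pm\theta_2,\dots)\in\Theta$ for every choice of signs. The quadratic convex hull of an orthosymmetric $\Theta$ is $\mathrm{Q.Hull}(\Theta)=\{(\theta_i)_{i\ge1}:(\theta_i^2)_{i\ge1}\in\mathrm{Hull}(\Theta_+^2)\}$, where $\Theta_+^2=\{(\theta_i^2)_{i\ge1}:\theta\in\Theta,\ \theta_i\ge0\ \forall i\}$ and $\mathrm{Hull}$ denotes the convex hull. A quadratic estimator is one of the form $\sum_{i,j}a_{i,j}Y_iY_j+c$; the class of all such is $\mathcal Q$; a diagonal quadratic estimator is one of the form $\sum_i a_iY_i^2+c$, the class of these being $\mathcal Q_D$. For a parameter set $\Theta$, $R_Q^*(n,\Theta)=\inf_{\hat Q\in\mathcal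 Q}\sup_{\theta\in\Theta}E_\theta(\hat Q-Q(\theta))^2$ and $R_{DQ}^*(n,\Theta)=\inf_{\hat Q\in\mathcal Q_D}\sup_{\theta\in\Theta}E_\theta(\hat Q-Q(\theta))^2$. *)

(* Defs.v *)
From HB Require Import structures.
From mathcomp Require Import all_boot all_order all_algebra.
From mathcomp Require Import all_classical all_reals all_analysis.
Set Implicit Arguments. Unset Strict Implicit. Unset Printing Implicit Defensive.
Import Order.TTheory GRing.Theory Num.Theory.
Import numFieldNormedType.Exports.
Local Open Scope classical_set_scope.
Local Open Scope ring_scope.

Section Defs.
Context {R : realType}.

Definition orthosymmetric (Th : set (nat -> R)) : Prop :=
  forall th, Th th -> forall eps : nat -> bool,
    Th (fun i => if eps i then - th i else th i).

Definition Theta_plus_sq (Th : set (nat -> R)) : set (nat -> R) :=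
  [set x | exists th, Th th /\ (forall i, 0 <= th i) /\ x = (fun i => th i ^+ 2)].

Definition Hull (A : set (nat -> R)) : set (nat -> R) :=
  [set x | exists (k : nat) (lam : 'I_k -> R) (p : 'I_k -> nat -> R),
     (forall j, 0 <= lam j) /\ \sum_(j < k) lam j = 1 /\ (forall j, A (p j)) /\
     x = (fun i => \sum_(j < k) lam j * p j i)].

Definition QHull (Th : set (nat -> R)) : set (nat -> R) :=
  [set th | Hull (Theta_plus_sq Th) (fun i => th i ^+ 2)].

Definition iid_std_normal d (T : measurableType d) (P : probability T R)
    (z : nat -> {RV P >-> R}) : Prop :=
  (forall i, distribution P (z i) = normal_prob 0 1) /\
  (forall (s : seq nat) (B : nat -> set R), uniq s -> (forall j, measurable (B j)) ->
     P (\bigcap_(j in [set j | j \in s]) (z j @^-1` B j)) =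
     (\prod_(j <- s) P (z j @^-1` B j))%E).

Definition Yobs d (T : measurableType d) (P : probability T R)
    (z : nat -> {RV P >-> R}) (n : nat) (th : nat -> R) (i : nat) (w : T) : R :=
  th i + (Num.sqrt (n%:R))^-1 * z i w.

Definition QN (th : nat -> R) (N : nat) : R := \sum_(i < N) th i ^+ 2.

Definition quadEstN d (T : measurableType d) (P : probability T R)
    (z : nat -> {RV P >-> R}) (n : nat) (A : nat -> nat -> R) (c : R)
    (th : nat -> R) (N : nat) (w : T) : R :=
  \sum_(i < N) \sum_(j < N) A i j * Yobs z n th i w * Yobs z n th j w + c.

Definition diagEstN d (T : measurableType d) (P : probability T R)
    (z : nat -> {RV P >-> R}) (n : nat) (a : nat -> R) (c : R)
    (th : nat -> R) (N : nat) (w : T) : R :=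
  \sum_(i < N) a i * Yobs z n th i w ^+ 2 + c.

(* mean squared error E_theta (Qhat - Q(theta))^2 of an estimator given by its
   truncations est N (which may depend on theta only through the data Y):
   the limit (superior) of the truncated mean squared errors, i.e. the
   L^2 convention for the infinite sums. *)
Definition mse d (T : measurableType d) (P : probability T R)
    (est : nat -> T -> R) (th : nat -> R) : \bar R :=
  limn_esup (fun N => (\int[P]_w ((est N w - QN th N) ^+ 2)%:E)%E).

Definition maxrisk_quad d (T : measurableType d) (P : probability T R)
    (z : nat -> {RV P >-> R}) (n : nat) (A : nat -> nat -> R) (c : R)
    (Th : set (nat -> R)) : \bar R :=
  ereal_sup [set mse P (quadEstN z n A c th) th | th in Th].

Definition maxrisk_diag d (T : measurableType d) (P : probability T R)
    (z : nat -> {RV P >-> R}) (n : nat) (a : nat -> R) (c : R)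
    (Th : set (nat -> R)) : \bar R :=
  ereal_sup [set mse P (diagEstN z n a c th) th | th in Th].

Definition RQstar d (T : measurableType d) (P : probability T R)
    (z : nat -> {RV P >-> R}) (n : nat) (Th : set (nat -> R)) : \bar R :=
  ereal_inf [set r | exists (A : nat -> nat -> R) (c : R), r = maxrisk_quad z n A c Th].

Definition RDQstar d (T : measurableType d) (P : probability T R)
    (z : nat -> {RV P >-> R}) (n : nat) (Th : set (nat -> R)) : \bar R :=
  ereal_inf [set r | exists (a : nat -> R) (c : R), r = maxrisk_diag z n a c Th].

End Defs.

(* Main.v *)
Require Import Defs.
From HB Require Import structures.
From mathcomp Require Import all_boot all_order all_algebra finmap.
From mathcomp Require Import all_classical all_reals all_analysis.
From mathcomp Require Import measurable_realfun ring lra.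
Import Order.TTheory GRing.Theory Num.Theory.
Import numFieldNormedType.Exports HBNNSimple.
Local Open Scope classical_set_scope.
Local Open Scope ring_scope.
Set Implicit Arguments. Unset Strict Implicit. Unset Printing Implicit Defensive.

(** With [t = v / n], [v = E z^2] and [l_i(x) = sum_j (A_ij + A_ji) x_j], the
    truncated risk of a quadratic estimator at [x] is
    [bias(x)^2 + t * sum_i l_i(x)^2 + K], where [K] does not depend on [x].

    For a diagonal estimator this is a convex function of [(x_i^2)], so it does
    not exceed its maximum over [Theta] on the quadratic hull.

    Conversely, averaging the risk of an arbitrary quadratic estimator over
    independent signs of the coordinates of [theta] bounds from above the risk of
    its diagonal part.  The mean squared error is a limit superior over
    truncations, and the worst sign vector may depend on the truncation, so one
    needs a reverse Fatou lemma over signs, hence a bound uniform in the signs: Baire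
    category provides it after fixing finitely many signs, and each of the fixed
    signs can then be released, because flipping one coordinate changes the
    risk in a controlled way. *)

(** * Densities and independence *)

Section density.
Context {R : realType} {d d' : measure_display}.
Context {T : measurableType d} {U : measurableType d'}.

(** The last hypothesis is the identity for indicators; linearity extends it to simple functions and
    monotone convergence to nonnegative [f]. It serves twice: to integrate out one independent
    factor, with [nu] its law, and to pass from the normal law to its density. *)
Lemma ge0_integral_density (mu : {measure set T -> \bar R})
    (nu : {measure set U -> \bar R}) (X : T -> U) (g : T -> R) (c : \bar R)
    (f : U -> R) :
  measurable_fun setT X -> measurable_fun setT g -> (forall w, 0 <= g w) ->
  (0 <= c)%E -> c \is a fin_num ->
  measurable_fun setT f -> (forall x, 0 <= f x) ->
  (forall B, measurable B ->
     (\int[mu]_w (g w * \1_B (X w))%:E = c * nu B)%E) ->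
  (\int[mu]_w (g w * f (X w))%:E = c * \int[nu]_x (f x)%:E)%E.
Proof.
move=> mX mg g0 c0 cfin mf f0 gB.
have mf' : measurable_fun setT (fun x => (f x)%:E) by exact/measurable_EFinP.
pose a := nnsfun_approx measurableT mf'.
have amE k : measurable_fun setT (fun w => a k (X w)).
  by apply: measurableT_comp.
have stepE k : (\int[mu]_w (g w * a k (X w))%:E = c * \int[nu]_x (a k x)%:E)%E.
  have aE x : a k x =
      \sum_(y <- fset_set (range (a k))) (y * \1_(a k @^-1` [set y]) x).
    by rewrite fimfunE fsbig_finite.
  have y0 y : y \in fset_set (range (a k)) -> 0 <= y.
    by rewrite in_fset_set// inE => -[x _ <-].
  have mi y : measurable_fun setT (fun w => \1_(a k @^-1` [set y]) (X w) : R).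
    exact: measurableT_comp.
  transitivity (\sum_(y <- fset_set (range (a k)))
      (y%:E * (c * nu (a k @^-1` [set y]))))%E.
    (* [Num.max y 0] equals [y] on the range of [a k] and is nonnegative for every other [y] too, as
       termwise integration requires. *)
    transitivity (\int[mu]_w \sum_(y <- fset_set (range (a k)))
      ((Num.max y 0)%:E * (g w * \1_(a k @^-1` [set y]) (X w))%:E))%E.
      apply: eq_integral => w _; rewrite aE mulr_sumr -sumEFin.
      apply: eq_big_seq => y /y0 yy; rewrite max_l// -EFinM; congr EFin; ring.
    rewrite ge0_integral_sum//.
    - apply: eq_big_seq => y /y0 yy; rewrite max_l//.
      rewrite ge0_integralZl_EFin//.
      + by rewrite gB.
      + by move=> w _; rewrite lee_fin mulr_ge0.
      + by apply/measurable_EFinP; apply: measurable_funM.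
    - move=> y; apply/measurable_EFinP; apply: measurable_funM => //.
      by apply: measurable_funM.
    - by move=> y w _; rewrite lee_fin mulr_ge0 ?le_max ?lexx ?orbT// mulr_ge0.
  have -> : (\int[nu]_x (a k x)%:E =
      \sum_(y <- fset_set (range (a k))) (y%:E * nu (a k @^-1` [set y])))%E.
    transitivity (\int[nu]_x \sum_(y <- fset_set (range (a k)))
      ((Num.max y 0)%:E * (\1_(a k @^-1` [set y]) x)%:E))%E.
      apply: eq_integral => x _; rewrite aE -sumEFin.
      by apply: eq_big_seq => y /y0 yy; rewrite max_l.
    rewrite ge0_integral_sum//.
    - apply: eq_big_seq => y /y0 yy; rewrite max_l//.
      rewrite ge0_integralZl_EFin//; last exact/measurable_EFinP.
      by rewrite integral_indic ?setIT.
    - by move=> y; apply/measurable_EFinP; apply: measurable_funM.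
    - by move=> y x _; rewrite lee_fin mulr_ge0 ?le_max ?lexx ?orbT.
  rewrite big_seq [in RHS]big_seq ge0_sume_distrr.
    by apply: eq_bigr => y _; rewrite muleCA.
  by move=> y /y0 yy; rewrite mule_ge0.
have acv x : (a k x)%:E @[k --> \oo] --> (f x)%:E.
  by apply: (cvg_nnsfun_approx measurableT mf') => // y _; rewrite lee_fin.
have and x : {homo (fun k => a k x) : m n / (m <= n)%N >-> m <= n}.
  by move=> m n mn; move/lefP : (nd_nnsfun_approx measurableT mf' mn); apply.
have cvl : (\int[mu]_w (g w * a k (X w))%:E)%E @[k --> \oo]
     --> (\int[mu]_w (g w * f (X w))%:E)%E.
  under eq_integral do rewrite EFinM.
  have -> : (\int[mu]_w ((g w)%:E * (f (X w))%:E) =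
      \int[mu]_w limn (fun k => (g w * a k (X w))%:E))%E.
    apply: eq_integral => w _; apply/esym/cvg_lim => //.
    under eq_fun do rewrite EFinM.
    exact: cvgeZl.
  apply: cvg_monotone_convergence => //.
  - by move=> k; apply/measurable_EFinP; apply: measurable_funM.
  - by move=> k w _; rewrite lee_fin mulr_ge0.
  - by move=> w _ m n mn; rewrite lee_fin ler_wpM2l// and.
have cvr : (\int[nu]_x (a k x)%:E)%E @[k --> \oo] --> (\int[nu]_x (f x)%:E)%E.
  have -> : (\int[nu]_x (f x)%:E = \int[nu]_x limn (fun k => (a k x)%:E))%E.
    by apply: eq_integral => x _; apply/esym/cvg_lim => //; exact: acv.
  apply: cvg_monotone_convergence => //.
  - by move=> k; exact/measurable_EFinP.
  - by move=> k x _; rewrite lee_fin.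
  - by move=> x _ m n mn; rewrite lee_fin and.
have cvr' := cvgeZl cfin cvr.
rewrite -(cvg_lim _ cvl)// -(cvg_lim _ cvr')//.
by congr (limn _); apply/funext => k; rewrite stepE.
Qed.

End density.

Section independence.
Context {R : realType} {d : measure_display} {T : measurableType d}.
Context {P : probability T R}.

Variable z : nat -> {RV P >-> R}.
Hypothesis indep_z : forall (s : seq nat) (B : nat -> set R), uniq s ->
  (forall j, measurable (B j)) ->
  P (\bigcap_(j in [set j | j \in s]) (z j @^-1` B j)) =
  (\prod_(j <- s) P (z j @^-1` B j))%E.

Let measurable_hz (h : R -> R) j : measurable_fun setT h ->
  measurable_fun setT (fun w => h (z j w)).
Proof. by move=> mh; apply: measurableT_comp. Qed.

(* [s1] lists the factors already freed from being indicators. *)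
Let ge0_integral_prod_indic (s1 s2 : seq nat) (h : nat -> R -> R) :
  uniq (s1 ++ s2) ->
  (forall j, measurable_fun setT (h j)) -> (forall j x, 0 <= h j x) ->
  (forall j, \int[P]_w (h j (z j w))%:E \is a fin_num)%E ->
  (forall j, j \in s2 -> exists2 B, measurable B & h j = \1_B) ->
  (\int[P]_w (\prod_(j <- s1 ++ s2) h j (z j w))%:E =
   \prod_(j <- s1 ++ s2) \int[P]_w (h j (z j w))%:E)%E.
Proof.
elim: s1 s2 h => [|j s1 IH] s2 h us mh h0 hfin hB.
  have /choice[B Bh] : forall j, exists B : set R,
      measurable B /\ (j \in s2 -> h j = \1_B).
    move=> j; have [js|js] := boolP (j \in s2); last by exists setT.
    by have [B mB hE] := hB j js; exists B.
  have mzB j : measurable (z j @^-1` B j).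
    by rewrite -[X in measurable X]setTI; apply: measurable_funPT => //; apply Bh.
  have iE j : j \in s2 -> (\int[P]_w (h j (z j w))%:E = P (z j @^-1` B j))%E.
    move=> js; rewrite (Bh j).2//.
    transitivity (\int[P]_w (\1_(z j @^-1` B j) w)%:E)%E => //.
    by rewrite integral_indic ?setIT.
  rewrite /= in us *.
  rewrite big_seq [in RHS](eq_bigr _ iE) -big_seq -indep_z//; last by move=> ?; apply Bh.
  rewrite -[in RHS](setIT (\bigcap_(_ in _) _)) -integral_indic//; last first.
    by apply: bigcap_measurableType => // ? _.
  apply: eq_integral => w _; congr EFin; rewrite indicE.
  have [wB|wB] := pselect ((\bigcap_(j in [set j | j \in s2]) (z j @^-1` B j)) w).
    rewrite mem_set//= big_seq big1// => j js.
    by rewrite (Bh j).2// indicE mem_set//; apply: wB.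
  rewrite memNset//=.
  have [j js jB] : exists2 j, j \in s2 & ~ B j (z j w).
    apply: contrapT => /forall2NP nj; apply: wB => j /= js.
    by case: (nj j) => // /contrapT.
  apply/eqP; rewrite prodf_seq_eq0; apply/hasP; exists j => //=.
  by rewrite (Bh j).2// indicE memNset.
have /= /andP[js us'] := us.
rewrite big_cons -IH//.
under eq_integral do rewrite big_cons mulrC.
(* The weight is the product of the factors other than [j]; its integral is the constant [c]. *)
rewrite (ge0_integral_density (nu := distribution P (z j))
  (c := (\int[P]_w (\prod_(i <- s1 ++ s2) h i (z i w))%:E)%E))//.
- rewrite muleC ge0_integral_distribution//; last by move=> x; rewrite lee_fin.
  exact/measurable_EFinP.
- by apply: measurable_prod => i _; apply: measurable_hz.
- by move=> w; apply: prodr_ge0 => i _.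
- by apply: integral_ge0 => w _; rewrite lee_fin; apply: prodr_ge0 => i _.
- rewrite IH//; elim: (s1 ++ s2) => [|i t iht]; rewrite ?big_nil// big_cons.
  by rewrite fin_numM.
move=> B mB.
(* With an indicator at [j], this index can move to the second list, where the induction hypothesis
   applies. *)
pose h' i := if i == j then \1_B : R -> R else h i.
have h'E i : i \in s1 ++ s2 -> h' i = h i.
  by rewrite /h'; case: eqVneq => // ->; rewrite (negPf js).
have h'j : h' j = \1_B by rewrite /h' eqxx.
have pE : perm_eq (s1 ++ j :: s2) (j :: s1 ++ s2) by apply/permPl/(perm_catCA s1 [:: j] s2).
transitivity (\int[P]_w (\prod_(i <- s1 ++ j :: s2) h' i (z i w))%:E)%E.
  apply: eq_integral => w _; congr EFin; rewrite (perm_big _ pE)/= big_cons h'j mulrC.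
  by congr (_ * _); apply: eq_big_seq => i /h'E ->.
rewrite IH//.
- rewrite (perm_big _ pE)/= big_cons h'j IH// muleC; congr (_ * _)%E.
    by apply: eq_big_seq => i /h'E ->.
  transitivity (\int[P]_w (\1_(z j @^-1` B) w)%:E)%E => //.
  rewrite integral_indic ?setIT//.
  by rewrite -[X in measurable X]setTI; apply: measurable_funPT.
- by rewrite (perm_uniq pE).
- by move=> i; rewrite /h'; case: ifP.
- by move=> i x; rewrite /h'; case: ifP.
- move=> i; rewrite /h'; case: ifP => // _.
  have -> : (\int[P]_w (\1_B (z i w))%:E = \int[P]_w (\1_(z i @^-1` B) w)%:E)%E by [].
  have mzB : measurable (z i @^-1` B).
    by rewrite -[X in measurable X]setTI; apply: measurable_funPT.
  by rewrite integral_indic// setIT fin_num_measure.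
- move=> i; rewrite inE => /predU1P[->|is2]; first by exists B.
  by rewrite h'E ?mem_cat ?is2 ?orbT//; apply: hB.
Qed.

(** Independence factors the integral of the product of absolute values into a finite product of
    finite numbers. *)
Lemma integrable_prod_indep (s : seq nat) (h : nat -> R -> R) :
  uniq s -> (forall j, measurable_fun setT (h j)) ->
  (forall j, P.-integrable setT (fun w => (h j (z j w))%:E)) ->
  P.-integrable setT (fun w => (\prod_(j <- s) h j (z j w))%:E).
Proof.
move=> us mh ih; apply/integrableP; split.
  by apply/measurable_EFinP; apply: measurable_prod => i _; apply: measurable_hz.
under eq_integral do rewrite /= normr_prod.
have nfin j : (\int[P]_w (`|h j (z j w)|)%:E \is a fin_num)%E.
  have /integrableP[_ ijoo] := ih j.
  by rewrite ge0_fin_numE//; apply: integral_ge0 => w _; rewrite lee_fin.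
have := @ge0_integral_prod_indic s [::] (fun j x => `|h j x|).
rewrite cats0 => ->//; last by move=> j; apply: measurableT_comp.
rewrite ltey_eq; apply/orP; left.
elim: (s) => [|i t iht]; rewrite ?big_nil// big_cons.
by rewrite fin_numM.
Qed.

(* Each sign-changing factor is split into positive and negative parts. *)
Let Rintegral_prod_pos (s1 s2 : seq nat) (h : nat -> R -> R) :
  uniq (s1 ++ s2) -> (forall j, measurable_fun setT (h j)) ->
  (forall j, P.-integrable setT (fun w => (h j (z j w))%:E)) ->
  (forall j, j \in s2 -> forall x, 0 <= h j x) ->
  \int[P]_w \prod_(j <- s1 ++ s2) h j (z j w) =
  \prod_(j <- s1 ++ s2) \int[P]_w h j (z j w).
Proof.
elim: s1 s2 h => [|j s1 IH] s2 h us mh ih hB.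
  rewrite cat0s in us *.
  transitivity (\int[P]_w \prod_(j <- s2) `|h j (z j w)|).
    apply: eq_Rintegral => w _; apply: eq_big_seq => j js.
    by rewrite ger0_norm ?hB.
  rewrite /Rintegral.
  have nfin j : (\int[P]_w (`|h j (z j w)|)%:E \is a fin_num)%E.
    have /integrableP[_ ijoo] := ih j.
    by rewrite ge0_fin_numE//; apply: integral_ge0 => w _; rewrite lee_fin.
  have := @ge0_integral_prod_indic s2 [::] (fun j x => `|h j x|).
  rewrite cats0 => ->//; last by move=> j; apply: measurableT_comp.
  rewrite -[LHS]/(fine (\prod_(j <- s2) (\int[P]_w (`|h j (z j w)|)%:E)%E)).
  transitivity (\prod_(j <- s2) fine (\int[P]_w (`|h j (z j w)|)%:E)%E).
    elim: (s2) => [|i t iht]; rewrite ?big_nil// !big_cons fineM// ?iht//.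
    by elim: (t) => [|k t' ih']; rewrite ?big_nil// big_cons fin_numM.
  apply: eq_big_seq => j js; congr fine; apply: eq_integral => w _.
  by rewrite ger0_norm ?hB.
have /= /andP[js us'] := us.
pose hp i := if i == j then (h j)^\+ else h i.
pose hn i := if i == j then (h j)^\- else h i.
have pE : perm_eq (s1 ++ j :: s2) (j :: s1 ++ s2) by apply/permPl/(perm_catCA s1 [:: j] s2).
have usp : uniq (s1 ++ j :: s2) by rewrite (perm_uniq pE).
have mp i : measurable_fun setT (hp i).
  by rewrite /hp; case: ifP => // _; exact: measurable_funrpos.
have mn i : measurable_fun setT (hn i).
  by rewrite /hn; case: ifP => // _; exact: measurable_funrneg.
have ip i : P.-integrable setT (fun w => (hp i (z i w))%:E).
  rewrite /hp; case: eqVneq => [->|_]//.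
  exact: (@integrable_funrpos _ _ _ P setT (fun w => h j (z j w)) measurableT (ih j)).
have iN i : P.-integrable setT (fun w => (hn i (z i w))%:E).
  rewrite /hn; case: eqVneq => [->|_]//.
  exact: (@integrable_funrneg _ _ _ P setT (fun w => h j (z j w)) measurableT (ih j)).
have hpB i : i \in j :: s2 -> forall x, 0 <= hp i x.
  rewrite inE /hp; case: eqVneq => [_ _ x|_ /= /hB//]; exact: funrpos_ge0.
have hnB i : i \in j :: s2 -> forall x, 0 <= hn i x.
  rewrite inE /hn; case: eqVneq => [_ _ x|_ /= /hB//]; exact: funrneg_ge0.
have hpE i : i \in s1 ++ s2 -> hp i = h i.
  by rewrite /hp; case: eqVneq => // ->; rewrite (negPf js).
have hnE i : i \in s1 ++ s2 -> hn i = h i.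
  by rewrite /hn; case: eqVneq => // ->; rewrite (negPf js).
have IHp := IH _ hp usp mp ip hpB.
have IHn := IH _ hn usp mn iN hnB.
have intp := integrable_prod_indep usp mp ip.
have intn := integrable_prod_indep usp mn iN.
transitivity (\int[P]_w (\prod_(i <- s1 ++ j :: s2) hp i (z i w) -
                         \prod_(i <- s1 ++ j :: s2) hn i (z i w))).
  apply: eq_Rintegral => w _; rewrite !(perm_big _ pE)/= !big_cons.
  rewrite [in X in _ = X - _](eq_big_seq (fun i => h i (z i w))); last first.
    by move=> i /hpE ->.
  rewrite [in X in _ = _ - X](eq_big_seq (fun i => h i (z i w))); last first.
    by move=> i /hnE ->.
  rewrite -mulrBl /hp /hn eqxx; congr (_ * _).
  exact/esym/(congr1 (@^~ (z j w)) (funrposBneg (h j))).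
rewrite RintegralB// IHp IHn !(perm_big _ pE)/= !big_cons.
rewrite [in X in X - _ = _](eq_big_seq (fun i => \int[P]_w h i (z i w))); last first.
  by move=> i /hpE ->.
rewrite [in X in _ - X = _](eq_big_seq (fun i => \int[P]_w h i (z i w))); last first.
  by move=> i /hnE ->.
rewrite -mulrBl; congr (_ * _).
have := ip j; have := iN j; rewrite /hp /hn !eqxx => inj ipj.
rewrite -RintegralB//; apply: eq_Rintegral => w _.
exact: (congr1 (@^~ (z j w)) (funrposBneg (h j))).
Qed.

Lemma Rintegral_prod_indep (s : seq nat) (h : nat -> R -> R) :
  uniq s -> (forall j, measurable_fun setT (h j)) ->
  (forall j, P.-integrable setT (fun w => (h j (z j w))%:E)) ->
  \int[P]_w \prod_(j <- s) h j (z j w) =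
  \prod_(j <- s) \int[P]_w h j (z j w).
Proof.
by move=> us mh ih; have := @Rintegral_prod_pos s [::] h; rewrite cats0; apply.
Qed.

End independence.

(** * Moments of the normal law *)

(** The value at [0] is [1], so that the square is [1] everywhere and not only almost everywhere. *)
Definition sgnb {R : realType} (x : R) : R := if x < 0 then -1 else 1.

Section std_normal.
Context {R : realType} {d : measure_display} {T : measurableType d}.
Context {P : probability T R}.
Local Notation mu := (@lebesgue_measure R).
Local Notation N01 := (@normal_prob R 0 1).

Let m1 : measurable_fun [set: R] (fun x : R => (0 <= x)%R%:R : R).
Proof.
rewrite (_ : (fun x => _) = \1_(`[0, +oo[ : set R)); first exact: measurable_indic.
by apply/funext => x; rewrite indicE mem_setE in_itv/= andbT.
Qed.

Let m2 : measurable_fun [set: R] (fun x : R => (x < 0)%R%:R : R).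
Proof.
rewrite (_ : (fun x => _) = \1_(`]-oo, 0[ : set R)); first exact: measurable_indic.
by apply/funext => x; rewrite indicE mem_setE in_itv.
Qed.

Lemma ge0_integral_std_normal (X : {RV P >-> R}) (f : R -> R) :
  distribution P X = N01 ->
  measurable_fun setT f -> (forall x, 0 <= f x) ->
  (\int[P]_w (f (X w))%:E = \int[mu]_x (normal_pdf 0 1 x * f x)%:E)%E.
Proof.
move=> XN mf f0.
rewrite (@ge0_integral_density _ _ _ _ _ mu (distribution P X) idfun (normal_pdf 0 1) 1%E f)//.
- rewrite mul1e (ge0_integral_distribution X (f := fun x => (f x)%:E))//.
  exact/measurable_EFinP.
- by move=> _ B mB; rewrite setTI.
- exact: measurable_normal_pdf.
- by move=> x; exact: normal_pdf_ge0.
- move=> B mB; rewrite mul1e; transitivity (N01 B); last by rewrite -XN.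
  rewrite /normal_prob [RHS]integral_mkcond.
  apply: eq_integral => x _; rewrite patchE indicE.
  by case: ifPn => xB; rewrite ?mulr1 ?mulr0.
Qed.

(** Half of the Gaussian exponent absorbs [x ^+ 4]; what remains is a multiple of the density of
    variance [2]. *)
Lemma std_normal_moment4 (X : {RV P >-> R}) :
  distribution P X = N01 -> (\int[P]_w (X w ^+ 4)%:E < +oo)%E.
Proof.
move=> XN.
pose s : R := Num.sqrt 2.
have s0 : s != 0 by rewrite gt_eqF// sqrtr_gt0.
have s2 : s ^+ 2 = 2 by rewrite sqr_sqrtr.
rewrite (ge0_integral_std_normal (f := fun x => x ^+ 4) XN)//; last first.
  by move=> x; rewrite exprn_even_ge0.
(* The peaks exchange the normalising constants; [64] comes from [x ^+ 4 = 64 * y ^+ 2] with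
   [y = x ^+ 2 / 8], where [y <= expR y]. *)
pose C : R := 64 * normal_peak 1 / normal_peak s.
have C0 : 0 <= C by rewrite divr_ge0 ?mulr_ge0 ?normal_peak_ge0.
apply: (@le_lt_trans _ _ (\int[mu]_x (C%:E * (normal_pdf 0 s x)%:E)))%E.
  apply: ge0_le_integral => //.
  - by move=> x _; rewrite lee_fin mulr_ge0 ?normal_pdf_ge0// exprn_even_ge0.
  - apply/measurable_EFinP; apply: measurable_funM; first exact: measurable_normal_pdf.
    exact: measurable_funX.
  - apply/measurable_EFinP; apply: measurable_funM => //.
    exact: measurable_normal_pdf.
  move=> x _; rewrite -EFinM lee_fin !normal_pdfE ?oner_eq0//.
  rewrite /normal_fun s2 subr0 expr1n /C.
  have -> : 64 * normal_peak 1 / normal_peak s * (normal_peak s * expR (- x ^+ 2 / (2 *+ 2))) =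
     normal_peak 1 * (64 * expR (- x ^+ 2 / (2 *+ 2))).
    by field; rewrite gt_eqF// normal_peak_gt0.
  rewrite -mulrA ler_wpM2l ?normal_peak_ge0//.
  have -> : - x ^+ 2 / (1 *+ 2) = - x ^+ 2 / (2 *+ 2) + - x ^+ 2 / (2 *+ 2) :> R by field.
  rewrite expRD mulrC mulrA ler_wpM2r ?expR_ge0//.
  set y := x ^+ 2 / 8.
  have -> : - x ^+ 2 / (2 *+ 2) = - (y + y) :> R by rewrite /y; field.
  rewrite expRN ler_pdivrMr ?expR_gt0// expRD.
  have y0 : 0 <= y by rewrite divr_ge0 ?sqr_ge0.
  have yE := expR_ge1Dx y.
  have -> : x ^+ 4 = 64 * (y * y) by rewrite /y; field.
  by rewrite ler_wpM2l// ler_pM//; lra.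
rewrite ge0_integralZl_EFin//.
- by rewrite integral_normal_pdf mule1 ltry.
- by move=> x _; rewrite lee_fin normal_pdf_ge0.
- by apply/measurable_EFinP; exact: measurable_normal_pdf.
Qed.

(** The normal density is even, so substituting [- x] for [x] exchanges the two half-lines. *)
Lemma std_normal_halves (X : {RV P >-> R}) k :
  distribution P X = N01 ->
  (\int[P]_w (`|X w| ^+ k * (0 <= X w)%R%:R)%:E =
   \int[P]_w (`|X w| ^+ k * (X w < 0)%R%:R)%:E)%E.
Proof.
move=> XN.
have mn : measurable_fun [set: R] (fun x : R => `|x| ^+ k).
  by apply: measurable_funX; exact: normr_measurable.
rewrite (ge0_integral_std_normal (f := fun x => `|x| ^+ k * (0 <= x)%R%:R) XN)//; last first.
  exact: measurable_funM.
rewrite (ge0_integral_std_normal (f := fun x => `|x| ^+ k * (x < 0)%R%:R) XN)//; last first.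
  exact: measurable_funM.
pose G (x : R) := normal_pdf 0 1 x * `|x| ^+ k.
have mG : measurable_fun [set: R] G.
  by apply: measurable_funM => //; exact: measurable_normal_pdf.
transitivity (\int[mu]_(x in `[0%R, +oo[) (G x)%:E)%E.
  rewrite [RHS]integral_mkcond; apply: eq_integral => x _.
  rewrite patchE mem_setE in_itv/= andbT.
  by case: ifPn => x0; rewrite ?mulr1 ?mulr0 ?mulr0.
transitivity (\int[mu]_(x in `]-oo, 0%R[) (G x)%:E)%E; last first.
  rewrite [LHS]integral_mkcond; apply: eq_integral => x _.
  rewrite patchE mem_setE in_itv/=.
  by case: ifPn => x0; rewrite ?mulr1 ?mulr0 ?mulr0.
(* Adding the null endpoint [0] makes both half-lines closed, as the substitution needs. *)
rewrite integral_itv_bndo_bndc; last exact/measurable_EFinP/measurable_funTS.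
rewrite -{2}oppr0 ge0_integration_by_substitutionNy//.
- apply: eq_integral => x _; congr EFin; rewrite /G/= normrN; congr (_ * _).
  by rewrite !normal_pdfE ?oner_eq0// /normal_fun !subr0 sqrrN.
- apply: continuous_subspaceT => x; apply: cvgM.
    by apply: continuous_normal_pdf; rewrite oner_eq0.
  apply: (@continuous_comp _ _ _ (fun y : R => `|y|) (fun y : R => y ^+ k)).
    exact: (@norm_continuous _ R^o).
  exact: exprn_continuous.
- by move=> x _; rewrite mulr_ge0 ?normal_pdf_ge0.
Qed.

Lemma integrable_std_normalX (X : {RV P >-> R}) k :
  distribution P X = N01 -> (k <= 4)%N ->
  P.-integrable setT (fun w => (X w ^+ k)%:E).
Proof.
move=> XN k4.
have mXk j : measurable_fun setT (fun w => X w ^+ j) by exact: measurable_funX.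
have i4 : P.-integrable setT (fun w => (X w ^+ 4)%:E).
  apply/integrableP; split; first exact/measurable_EFinP.
  under eq_integral do rewrite /= ger0_norm ?exprn_even_ge0//.
  exact: std_normal_moment4.
apply: (@le_integrable _ _ _ _ _ measurableT _ (fun w => (1 + X w ^+ 4)%:E)).
- exact/measurable_EFinP.
- move=> w _; rewrite !abse_EFin lee_fin normrX.
  have X4 : 0 <= X w ^+ 4 by rewrite exprn_even_ge0.
  rewrite [leRHS]ger0_norm ?addr_ge0//.
  have [X1|X1] := leP `|X w| 1.
    by apply: (le_trans (exprn_ile1 k (normr_ge0 _) X1)); rewrite lerDl.
  have -> : X w ^+ 4 = `|X w| ^+ 4 by rewrite -normrX ger0_norm.
  by rewrite (@le_trans _ _ (`|X w| ^+ 4)) ?lerDr// ler_eXn2l.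
- rewrite (_ : (fun w => _) = (cst 1%:E \+ (fun w => (X w ^+ 4)%:E))%E)//.
  by apply: integrableD => //; exact: finite_measure_integrable_cst.
Qed.

Lemma integrable_sgnb (X : {RV P >-> R}) : P.-integrable setT (fun w => (sgnb (X w))%:E).
Proof.
apply: (@le_integrable _ _ _ _ _ measurableT _ (fun w => 1%:E)).
- apply/measurable_EFinP; apply: measurable_fun_ifT => //.
  by apply: measurable_fun_ltr.
- by move=> w _; rewrite lee_fin /sgnb; case: ifP => _; rewrite ?normrN normr1.
- exact: finite_measure_integrable_cst.
Qed.

(** The integrand is the difference of the two halves compared in [std_normal_halves]. The case
    [k = 0] gives centred signs, odd [k] gives the odd moments. *)
Let Rintegral_odd (X : {RV P >-> R}) k :
  distribution P X = N01 -> (k <= 4)%N ->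
  \int[P]_w (`|X w| ^+ k * sgnb (X w)) = 0.
Proof.
move=> XN k4.
have mX : measurable_fun setT (X : T -> R) by [].
have m1X : measurable_fun setT (fun w => (0 <= X w)%R%:R : R).
  exact: (measurableT_comp m1).
have m2X : measurable_fun setT (fun w => (X w < 0)%R%:R : R).
  exact: (measurableT_comp m2).
have mn : measurable_fun setT (fun w => `|X w| ^+ k).
  by apply: measurable_funX; exact: measurableT_comp.
have iX := integrable_std_normalX XN k4.
have iX1 : P.-integrable setT (EFin \o (fun w => `|X w| ^+ k * (0 <= X w)%R%:R)).
  apply: (le_integrable _ _ _ iX) => //.
    by apply/measurable_EFinP; exact: measurable_funM.
  move=> w _; rewrite lee_fin normrM !normrX normr_id.
  by case: (0 <= X w)%R; rewrite ?normr1 ?mulr1// normr0 mulr0 exprn_ge0.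
have iX2 : P.-integrable setT (EFin \o (fun w => `|X w| ^+ k * (X w < 0)%R%:R)).
  apply: (le_integrable _ _ _ iX) => //.
    by apply/measurable_EFinP; exact: measurable_funM.
  move=> w _; rewrite lee_fin normrM !normrX normr_id.
  by case: (X w < 0)%R; rewrite ?normr1 ?mulr1// normr0 mulr0 exprn_ge0.
transitivity (\int[P]_w (`|X w| ^+ k * (0 <= X w)%R%:R - `|X w| ^+ k * (X w < 0)%R%:R)).
  apply: eq_Rintegral => w _; rewrite -mulrBr /sgnb; congr (_ * _).
  by case: ltP; rewrite ?sub0r ?subr0.
rewrite RintegralB// /Rintegral.
by rewrite (std_normal_halves k XN) subrr.
Qed.

Lemma Rintegral_sgnb (X : {RV P >-> R}) :
  distribution P X = N01 -> \int[P]_w sgnb (X w) = 0.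
Proof.
move=> XN; rewrite -(@Rintegral_odd X 0)//; apply: eq_Rintegral => w _.
by rewrite expr0 mul1r.
Qed.

Lemma std_normal_odd_moment (X : {RV P >-> R}) k :
  distribution P X = N01 -> odd k -> (k <= 4)%N -> \int[P]_w (X w ^+ k) = 0.
Proof.
move=> XN ok k4; rewrite -(@Rintegral_odd X k)//; apply: eq_Rintegral => w _.
rewrite /sgnb; case: ltP => X0; last by rewrite mulr1 ger0_norm.
by rewrite mulrN1 ltr0_norm// exprNn -signr_odd ok expr1 mulN1r opprK.
Qed.

(** A zero second moment would make [X] vanish almost surely, whereas the normal law gives the point
    [0] no mass. *)
Lemma std_normal_moment2_gt0 (X : {RV P >-> R}) : distribution P X = N01 ->
  0 < \int[P]_w (X w ^+ 2).
Proof.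
move=> XN; rewrite lt_def Rintegral_ge0 ?andbT; last first.
  by move=> w _; rewrite sqr_ge0.
apply/eqP => E0.
have mX : measurable_fun setT (X : T -> R) by [].
have X20 : (\int[P]_w `|(X w ^+ 2)%:E| = 0)%E.
  under eq_integral do rewrite gee0_abs ?lee_fin ?sqr_ge0//.
  rewrite -(fineK (integrable_fin_num measurableT (integrable_std_normalX XN (isT : (2 <= 4)%N)))).
  by rewrite -[X in X%:E]/(\int[P]_w (X w ^+ 2)) E0.
have mX2 : measurable_fun setT (fun w => (X w ^+ 2)%:E).
  by apply/measurable_EFinP; exact: measurable_funX.
have /ae_eq_integral_abs X0 := X20.
have XN0 : {ae P, forall w, X w != 0}.
  exists (X @^-1` [set 0]); split.
  - by rewrite -[X in measurable X]setTI; exact: mX.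
  - have -> : P (X @^-1` [set 0]) = distribution P X [set 0] by [].
    by rewrite XN /normal_prob integral_set1.
  - by move=> w /negP; rewrite negbK => /eqP.
have : {ae P, forall w, False}.
  apply: filterS2 (X0 measurableT mX2) XN0 => w /(_ Logic.I) /= [] /eqP.
  by rewrite sqrf_eq0 => ->.
move=> [B [mB PB0 /(_ _ _) sB]].
have BT : B = setT by apply/seteqP; split => // w _; apply: sB => /=; apply.
by move: PB0; rewrite BT probability_setT => /eqP; rewrite onee_eq0.
Qed.

Lemma std_normal_same_moment (X Y : {RV P >-> R}) k :
  distribution P X = N01 -> distribution P Y = N01 -> (k <= 4)%N ->
  \int[P]_w (X w ^+ k) = \int[P]_w (Y w ^+ k).
Proof.
move=> XN YN k4; rewrite /Rintegral.
have mk : measurable_fun [set: R] (fun x : R => (x ^+ k)%:E).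
  by apply/measurable_EFinP; exact: measurable_funX.
have := integral_distribution mk (integrable_std_normalX XN k4).
have := integral_distribution mk (integrable_std_normalX YN k4).
by rewrite XN YN /= => -> ->.
Qed.

End std_normal.

(** * Square-integrable functions and moments of the noise *)

Section square_integrable.
Context {R : realType} {d : measure_display} {T : measurableType d}.
Context {P : probability T R}.
Local Notation intg f := (P.-integrable setT (fun w => (f w)%:E)).

Lemma eq_RintegralT (f g : T -> R) : f =1 g -> \int[P]_w f w = \int[P]_w g w.
Proof. by move=> fg; apply: eq_Rintegral => w _. Qed.

Lemma Rintegral_cstP (c : R) : \int[P]_w c = c.
Proof.
by rewrite Rintegral_cst// [X in fine X](_ : _ = 1%E) ?mulr1//; exact: probability_setT.
Qed.

Lemma integrableDR f g : intg f -> intg g -> intg (fun w => f w + g w).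
Proof. by move=> fi gi; exact: (integrableD measurableT fi gi). Qed.

Lemma integrableZR c f : intg f -> intg (fun w => c * f w).
Proof. by move=> fi; exact: (integrableZl measurableT c fi). Qed.

Definition sq_integrable (f : T -> R) :=
  measurable_fun setT f /\ intg (fun w => f w ^+ 2).

Lemma sq_integrableM f g : sq_integrable f -> sq_integrable g ->
  intg (fun w => f w * g w).
Proof.
move=> [mf f2] [mg g2].
apply: (@le_integrable _ _ _ _ _ measurableT _ (fun w => (f w ^+ 2 + g w ^+ 2)%:E)).
- by apply/measurable_EFinP; exact: measurable_funM.
- move=> w _; rewrite !abse_EFin lee_fin normrM.
  rewrite [leRHS]ger0_norm ?addr_ge0 ?sqr_ge0//.
  rewrite -(real_normK (num_real (f w))) -(real_normK (num_real (g w))).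
  have := sqr_ge0 (`|f w| - `|g w|).
  by have := normr_ge0 (f w); have := normr_ge0 (g w); nra.
- exact: (integrableD measurableT f2 g2).
Qed.

Lemma sq_integrable_cst c : sq_integrable (fun=> c).
Proof. by split=> //; exact: (finite_measure_integrable_cst _ (c ^+ 2)). Qed.

Lemma sq_integrable_intg f : sq_integrable f -> intg f.
Proof.
move=> fL; have := sq_integrableM fL (sq_integrable_cst 1).
by under eq_fun do rewrite mulr1.
Qed.

Lemma sq_integrableD f g : sq_integrable f -> sq_integrable g ->
  sq_integrable (fun w => f w + g w).
Proof.
move=> fL gL; split; first by apply: measurable_funD; [case: fL|case: gL].
rewrite (_ : (fun w => _) = (fun w => (f w ^+ 2)%:E + 2%:E * (f w * g w)%:E + (g w ^+ 2)%:E)%E).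
  apply: integrableD => //; last by case: gL.
  apply: integrableD => //; first by case: fL.
  by apply: integrableZl => //; exact: sq_integrableM.
by apply/funext => w; rewrite -EFinM -!EFinD; congr EFin; ring.
Qed.

Lemma sq_integrableZ c f : sq_integrable f -> sq_integrable (fun w => c * f w).
Proof.
move=> [mf f2]; split; first exact: measurable_funM.
rewrite (_ : (fun w => _) = (fun w => (c ^+ 2)%:E * (f w ^+ 2)%:E)%E).
  exact: integrableZl.
by apply/funext => w; rewrite -EFinM exprMn.
Qed.

Lemma sq_integrable_sum (I : Type) (s : seq I) (f : I -> T -> R) :
  (forall i, sq_integrable (f i)) -> sq_integrable (fun w => \sum_(i <- s) f i w).
Proof.
move=> fL; elim: s => [|i s IH].
  by (under eq_fun do rewrite big_nil); exact: sq_integrable_cst.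
by (under eq_fun do rewrite big_cons); exact: sq_integrableD.
Qed.

Lemma integrable_sumR (I : Type) (s : seq I) (f : I -> T -> R) :
  (forall i, intg (f i)) -> intg (fun w => \sum_(i <- s) f i w).
Proof.
move=> fi; under eq_fun do rewrite -sumEFin.
exact: integrable_sum.
Qed.

Lemma Rintegral_sum (I : Type) (s : seq I) (f : I -> T -> R) :
  (forall i, intg (f i)) ->
  \int[P]_w (\sum_(i <- s) f i w) = \sum_(i <- s) \int[P]_w f i w.
Proof.
move=> fi; elim: s => [|i s IH].
  by (under eq_RintegralT do rewrite big_nil); rewrite big_nil Rintegral_cst// mul0r.
under eq_RintegralT do rewrite big_cons.
rewrite big_cons -IH RintegralD//; first exact: fi.
exact: integrable_sumR.
Qed.

Lemma Rintegral_lin (I : finType) (a : I -> R) (f : I -> T -> R) :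
  (forall i, sq_integrable (f i)) ->
  \int[P]_w (\sum_i a i * f i w) = \sum_i a i * \int[P]_w f i w.
Proof.
move=> fL; rewrite Rintegral_sum => [|i].
  by apply: eq_bigr => i _; rewrite RintegralZl//; exact: sq_integrable_intg.
exact/sq_integrable_intg/sq_integrableZ.
Qed.

Lemma Rintegral_bilin (I J : finType) (a : I -> R) (f : I -> T -> R)
    (b : J -> R) (g : J -> T -> R) :
  (forall i, sq_integrable (f i)) -> (forall j, sq_integrable (g j)) ->
  \int[P]_w ((\sum_i a i * f i w) * (\sum_j b j * g j w)) =
  \sum_i \sum_j a i * b j * \int[P]_w (f i w * g j w).
Proof.
move=> fL gL.
have fgL i j : intg (fun w => f i w * g j w) by exact: sq_integrableM.
have afbgL i j : intg (fun w => (a i * f i w) * (b j * g j w)).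
  by apply: sq_integrableM; exact: sq_integrableZ.
under eq_RintegralT do rewrite big_distrlr/=.
rewrite Rintegral_sum => [|i]; last exact: integrable_sumR.
apply: eq_bigr => i _; rewrite Rintegral_sum//; apply: eq_bigr => j _.
by (under eq_RintegralT do rewrite mulrACA); rewrite RintegralZl//; exact: fgL.
Qed.

(** Pythagoras. It is applied to the noise variables with [m = v] and to random signs with
    [m = 1]. *)
Lemma Rintegral_sqr_orthogonal (I : finType) (a : I -> R) (f : I -> T -> R) (m : R) :
  (forall i, sq_integrable (f i)) ->
  (forall i j, \int[P]_w (f i w * f j w) = if i == j then m else 0) ->
  \int[P]_w ((\sum_i a i * f i w) ^+ 2) = m * \sum_i a i ^+ 2.
Proof.
move=> fL fv; under eq_RintegralT do rewrite expr2.
rewrite Rintegral_bilin// mulr_sumr; apply: eq_bigr => i _.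
rewrite (bigD1 i)//= fv eqxx big1 ?addr0 => [|j ji]; first by rewrite mulrC expr2.
by rewrite fv eq_sym (negPf ji) mulr0.
Qed.

End square_integrable.

Section product_moments.
Context {R : realType} {d : measure_display} {T : measurableType d}.
Context {P : probability T R}.
Variable z : nat -> {RV P >-> R}.
Hypothesis iid_z : iid_std_normal z.
Local Notation intg f := (P.-integrable setT (fun w => (f w)%:E)).

Let zN i : distribution P (z i) = normal_prob 0 1 := iid_z.1 i.

(** Index [0] represents all indices, because the [z i] share one law. *)
Definition noise_var : R := \int[P]_w (z 0 w ^+ 2).
Local Notation v := noise_var.

Lemma noise_var_gt0 : 0 < v. Proof. exact: std_normal_moment2_gt0. Qed.

(** Repeated indices are gathered into powers, since independence concerns distinct indices. *)
Let prod_count (r : seq nat) w :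
  \prod_(j <- r) z j w = \prod_(j <- undup r) z j w ^+ count_mem j r.
Proof. by rewrite -big_undup_iterop_count. Qed.

Lemma integrable_noise_prod (r : seq nat) : (size r <= 4)%N ->
  intg (fun w => \prod_(j <- r) z j w).
Proof.
move=> r4; under eq_fun do rewrite prod_count.
apply: (integrable_prod_indep (z := z) iid_z.2 (h := fun j x => x ^+ count_mem j r)) => //.
- exact: undup_uniq.
- move=> j; apply: integrable_std_normalX => //.
  exact: leq_trans (count_size _ _) r4.
Qed.

(** After gathering, the factor at [j] is an odd power of a symmetric variable, and its zero mean
    annihilates the product. *)
Lemma Rintegral_noise_prod_odd (r : seq nat) j : (size r <= 4)%N ->
  odd (count_mem j r) -> \int[P]_w \prod_(i <- r) z i w = 0.
Proof.
move=> r4 rj; under eq_RintegralT do rewrite prod_count.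
have c4 i : (count_mem i r <= 4)%N by exact: leq_trans (count_size _ _) r4.
have := Rintegral_prod_indep (z := z) iid_z.2 (h := fun j x => x ^+ count_mem j r).
move=> ->; [|exact: undup_uniq| |].
- apply/eqP; rewrite prodf_seq_eq0; apply/hasP; exists j.
    by rewrite mem_undup -has_pred1 has_count; case: count rj.
  by rewrite /= (std_normal_odd_moment (zN j) rj).
- by move=> i; exact: measurable_funX.
- by move=> i; exact: integrable_std_normalX.
Qed.

Lemma Rintegral_noise i : \int[P]_w z i w = 0.
Proof.
rewrite -(@Rintegral_noise_prod_odd [:: i] i)//= ?eqxx//.
by apply: eq_RintegralT => w; rewrite big_seq1.
Qed.

Lemma Rintegral_noise2 i j : \int[P]_w (z i w * z j w) = if i == j then v else 0.
Proof.
case: eqVneq => [<-|ij].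
  under eq_RintegralT do rewrite -expr2.
  exact: std_normal_same_moment.
rewrite -(@Rintegral_noise_prod_odd [:: i; j] i)//=; last by rewrite eqxx eq_sym (negPf ij).
by apply: eq_RintegralT => w; rewrite big_cons big_seq1.
Qed.

Lemma Rintegral_noise3 i j k : \int[P]_w (z i w * (z j w * z k w)) = 0.
Proof.
(* Among three indices some value occurs an odd number of times. *)
have [p pE] : exists p, odd (count_mem p [:: i; j; k]).
  have [ij|ij] := eqVneq i j; first by exists k; rewrite /= ij eqxx; case: eqP.
  have [ik|ik] := eqVneq i k.
    by exists j; rewrite /= -ik eqxx (negPf ij).
  by exists i; rewrite /= eqxx ![_ == i]eq_sym (negPf ij) (negPf ik).
rewrite -(Rintegral_noise_prod_odd _ pE)//; apply: eq_Rintegral => w _.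
by rewrite !big_cons big_nil mulr1.
Qed.

(** As [i] and [j] differ, [i] occurs once or three times among [p, p, i, j]. *)
Lemma Rintegral_noise4 p i j : i != j ->
  \int[P]_w (z p w * z p w * (z i w * z j w)) = 0.
Proof.
move=> ij; rewrite -(@Rintegral_noise_prod_odd [:: p; p; i; j] i)//=; last first.
  by rewrite eqxx [j == i]eq_sym (negPf ij); case: (p == i).
by apply: eq_RintegralT => w; rewrite !big_cons big_nil mulr1 !mulrA.
Qed.

Lemma sq_integrable_noise i : sq_integrable (P := P) (z i).
Proof. by split=> //; exact: integrable_std_normalX. Qed.

Lemma sq_integrable_noise2 i j : sq_integrable (P := P) (fun w => z i w * z j w).
Proof.
split; first exact: measurable_funM.
have := @integrable_noise_prod [:: i; j; i; j] isT; congr (_.-integrable _ _).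
by apply/funext => w; congr EFin; rewrite !big_cons big_nil expr2; ring.
Qed.

End product_moments.

(** * The truncated risk *)

(** The mean error of the truncated estimator when [t] is the variance of one observation; the trace
    term comes from the squared noise. *)
Definition qbias {R : realType} (t : R) (A : nat -> nat -> R) (c : R) (N : nat)
    (x : nat -> R) : R :=
  \sum_(i < N) \sum_(j < N) A i j * x i * x j + c - QN x N +
  t * \sum_(i < N) A i i.

(** The gradient of the quadratic form: up to the noise level, the coefficient of [z i] in the
    error. *)
Definition qslope {R : realType} (A : nat -> nat -> R) (N : nat) (x : nat -> R)
    (i : nat) : R := \sum_(j < N) (A i j + A j i) * x j.

(** [K] stands for the risk of the purely quadratic noise. It stays abstract because the sign
    arguments use only [0 <= K N] and a comparison with its counterpart for the diagonal part. *)
Definition qrisk {R : realType} (t : R) (K : nat -> R) (A : nat -> nat -> R) (c : R)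
    (N : nat) (x : nat -> R) : R :=
  qbias t A c N x ^+ 2 + t * \sum_(i < N) qslope A N x i ^+ 2 + K N.

Definition diag_of {R : realType} (a : nat -> R) (i j : nat) : R :=
  if i == j then a i else 0.

Section risk.
Context {R : realType} {d : measure_display} {T : measurableType d}.
Context {P : probability T R}.
Variable z : nat -> {RV P >-> R}.
Hypothesis iid_z : iid_std_normal z.
Local Notation intg f := (P.-integrable setT (fun w => (f w)%:E)).
Local Notation v := (noise_var z).

(* Centred noise products: orthogonal to the [z k] and, off the diagonal, to the
   diagonal ones. *)
Let cnoise (ij : nat * nat) w : R :=
  z ij.1 w * z ij.2 w - (if ij.1 == ij.2 then v else 0).

Let sq_integrable_cnoise ij : sq_integrable (P := P) (cnoise ij).
Proof.
apply: sq_integrableD; last exact: sq_integrable_cst.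
exact: sq_integrable_noise2.
Qed.

Let Rintegral_cnoise ij : \int[P]_w cnoise ij w = 0.
Proof.
rewrite RintegralB//.
- by rewrite Rintegral_noise2// Rintegral_cstP subrr.
- by apply: sq_integrable_intg; exact: sq_integrable_noise2.
- by apply: sq_integrable_intg; exact: sq_integrable_cst.
Qed.

Let Rintegral_noise_cnoise k ij : \int[P]_w (z k w * cnoise ij w) = 0.
Proof.
under eq_RintegralT do rewrite mulrBr.
rewrite RintegralB//; last 2 first.
- exact: (sq_integrableM (sq_integrable_noise iid_z k) (sq_integrable_noise2 iid_z _ _)).
- exact: (sq_integrableM (sq_integrable_noise iid_z k) (sq_integrable_cst _)).
rewrite Rintegral_noise3// RintegralZr//; last first.
  exact/sq_integrable_intg/sq_integrable_noise.
by rewrite Rintegral_noise// mul0r subrr.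
Qed.

Let Rintegral_cnoise_orth p ij : ij.1 != ij.2 ->
  \int[P]_w (cnoise (p, p) w * cnoise ij w) = 0.
Proof.
move=> ij0; rewrite /cnoise/= (negPf ij0) eqxx.
under eq_RintegralT do rewrite subr0 mulrBl.
rewrite RintegralB//; last 2 first.
- exact: (sq_integrableM (sq_integrable_noise2 iid_z _ _) (sq_integrable_noise2 iid_z _ _)).
- exact: (sq_integrableM (sq_integrable_cst _) (sq_integrable_noise2 iid_z _ _)).
rewrite Rintegral_noise4// RintegralZl//; last first.
  exact/sq_integrable_intg/sq_integrable_noise2.
by rewrite Rintegral_noise2// (negPf ij0) mulr0 subrr.
Qed.

Let noise (A : nat -> nat -> R) N w : R :=
  \sum_(ij : 'I_N * 'I_N) A ij.1 ij.2 * cnoise (ij.1 : nat, ij.2 : nat) w.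

Let sq_integrable_noiseA A N : sq_integrable (P := P) (noise A N).
Proof. by apply: sq_integrable_sum => ij; exact: sq_integrableZ. Qed.

Definition noise_risk (A : nat -> nat -> R) N : R := \int[P]_w (noise A N w ^+ 2).

Lemma noise_risk_ge0 A N : 0 <= noise_risk A N.
Proof. by apply: Rintegral_ge0 => w _; exact: sqr_ge0. Qed.

(** The noise of the diagonal part and that of the off-diagonal part are orthogonal, so their risks
    add up to that of [A]. *)
Lemma noise_risk_diag A N :
  noise_risk (diag_of (fun i => A i i)) N <= noise_risk A N.
Proof.
pose D := diag_of (fun i => A i i).
pose O i j := if i == j then 0 else A i j.
have AE w : noise A N w = noise D N w + noise O N w.
  rewrite /noise -big_split; apply: eq_bigr => ij _ /=; rewrite -mulrDl.
  by congr (_ * _); rewrite /D /diag_of /O; case: eqP => [->|]; rewrite ?addr0 ?add0r.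
have DO0 : \int[P]_w (noise D N w * noise O N w) = 0.
  rewrite Rintegral_bilin//; apply: big1 => -[i j] _; apply: big1 => -[k l] _ /=.
  rewrite /D /diag_of /O; case: eqVneq => [ij|]; last by rewrite !mul0r.
  case: eqVneq => [|kl]; first by rewrite mulr0 mul0r.
  by rewrite ij Rintegral_cnoise_orth ?mulr0.
have LD := sq_integrable_noiseA D N.
have LO := sq_integrable_noiseA O N.
have -> : noise_risk A N = noise_risk D N + noise_risk O N.
  rewrite /noise_risk.
  transitivity (\int[P]_w (noise D N w ^+ 2 + noise O N w ^+ 2 +
                            2 * (noise D N w * noise O N w))).
    by apply: eq_RintegralT => w; rewrite AE; ring.
  rewrite RintegralD//; last 2 first.
  - by apply: integrableDR; [case: LD|case: LO].
  - by apply: integrableZR; exact: sq_integrableM.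
  rewrite RintegralD//; last 2 first.
  - by case: LD.
  - by case: LO.
  rewrite RintegralZl//; last exact: sq_integrableM.
  by rewrite DO0 mulr0 addr0.
by rewrite lerDl noise_risk_ge0.
Qed.

Variable n : nat.
Local Notation s := ((Num.sqrt (n%:R : R))^-1).

(** Expansion of [Y = x + s z] in powers of [s]; centring the products of noise moves their mean
    into the bias. *)
Let quadEstE A c x N w : quadEstN z n A c x N w - QN x N =
  qbias (s ^+ 2 * v) A c N x + s * (\sum_(i < N) qslope A N x i * z i w) +
  s ^+ 2 * noise A N w.
Proof.
rewrite /quadEstN /qbias /noise /cnoise /Yobs -/s.
have -> : \sum_(i < N) qslope A N x i * z i w =
  \sum_(i < N) \sum_(j < N) (A i j * x i * z j w + A i j * z i w * x j).
  under [RHS]eq_bigr do rewrite big_split.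
  rewrite big_split/= [X in _ = X + _]exchange_big -big_split/=.
  apply: eq_bigr => i _; rewrite /qslope mulr_suml -big_split/=.
  by apply: eq_bigr => j _; ring.
(* As a double sum, the trace can be matched with the other terms entry by entry. *)
have -> : \sum_(i < N) A i i = \sum_(i < N) \sum_(j < N) A i j * (i == j :> nat)%:R.
  apply: eq_bigr => i _; rewrite (bigD1 i)//= eqxx mulr1 big1 ?addr0// => j ji.
  by rewrite eq_sym (negPf ji : (j == i :> nat) = false) mulr0.
rewrite -(pair_bigA _ (fun i j : 'I_N => A i j * (z i w * z j w - (if i == j :> nat then v else 0))))/=.
rewrite !mulr_sumr.
transitivity (\sum_(i < N) (\sum_(j < N) A i j * x i * x j +
   s ^+ 2 * v * (\sum_(j < N) A i j * (i == j :> nat)%:R) +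
   s * (\sum_(j < N) (A i j * x i * z j w + A i j * z i w * x j)) +
   s ^+ 2 * (\sum_(j < N) A i j * (z i w * z j w - (if i == j :> nat then v else 0)))) + c - QN x N).
  congr (_ + _ - _); apply: eq_bigr => i _.
  rewrite !mulr_sumr -!big_split/=; apply: eq_bigr => j _.
  by case: ifP => _; rewrite ?mulr1 ?mulr0; ring.
by rewrite !big_split/=; ring.
Qed.

Let sq_integrable_linear A N x :
  sq_integrable (P := P) (fun w => \sum_(i < N) qslope A N x i * z i w).
Proof.
by apply: sq_integrable_sum => i; apply: sq_integrableZ; exact: sq_integrable_noise.
Qed.

(** The constant, linear and centred quadratic parts of the error are pairwise orthogonal, so only
    their squares contribute. *)
Lemma quadEst_risk A c x N :
  (\int[P]_w ((quadEstN z n A c x N w - QN x N) ^+ 2)%:E)%E =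
  (qrisk (s ^+ 2 * v) (fun N => s ^+ 4 * noise_risk A N) A c N x)%:E.
Proof.
set b := qbias (s ^+ 2 * v) A c N x.
pose L w := \sum_(i < N) qslope A N x i * z i w.
have LL : sq_integrable (P := P) L by exact: sq_integrable_linear.
have LC := sq_integrable_noiseA A N.
have Lb := sq_integrable_cst (P := P) b.
have LW : sq_integrable (P := P) (fun w => b + s * L w + s ^+ 2 * noise A N w).
  by apply: sq_integrableD; [apply: sq_integrableD => //|]; exact: sq_integrableZ.
under eq_integral do rewrite quadEstE -/(L _).
rewrite -(fineK (integrable_fin_num measurableT LW.2)) -/(Rintegral _ _ _).
congr EFin; rewrite /qrisk.
have EL : \int[P]_w L w = 0.
  rewrite Rintegral_lin => [|i]; last exact: sq_integrable_noise.
  by rewrite big1// => i _; rewrite Rintegral_noise// mulr0.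
have EC : \int[P]_w noise A N w = 0.
  by rewrite Rintegral_lin// big1// => i _; rewrite Rintegral_cnoise mulr0.
have ELC : \int[P]_w (L w * noise A N w) = 0.
  rewrite Rintegral_bilin//; last by move=> i; exact: sq_integrable_noise.
  by apply: big1 => i _; apply: big1 => j _; rewrite Rintegral_noise_cnoise mulr0.
have EL2 : \int[P]_w (L w ^+ 2) = v * \sum_(i < N) qslope A N x i ^+ 2.
  rewrite (@Rintegral_sqr_orthogonal _ _ _ _ _ _ _ v)// => [i|i j].
    exact: sq_integrable_noise.
  exact: Rintegral_noise2.
(* The six monomials of the expanded square; [a] lists their coefficients. *)
pose f (k : 'I_6) w : R := nth 0 [:: 1; L w ^+ 2; noise A N w ^+ 2; L w; noise A N w; L w * noise A N w] k.
pose a (k : 'I_6) : R := nth 0 [:: b ^+ 2; s ^+ 2; s ^+ 4; 2 * b * s; 2 * b * s ^+ 2; 2 * s ^+ 3] k.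
have fi k : intg (f k).
  case: k => -[|[|[|[|[|[|//]]]]]] k6; rewrite /f/=.
  - exact: (sq_integrable_intg (sq_integrable_cst 1)).
  - by case: LL.
  - by case: LC.
  - exact: sq_integrable_intg.
  - exact: sq_integrable_intg.
  - exact: sq_integrableM.
transitivity (\int[P]_w (\sum_(k < 6) a k * f k w)).
  by apply: eq_RintegralT => w; rewrite !big_ord_recr big_ord0 /a /f/=; ring.
rewrite Rintegral_sum => [|k]; last exact: integrableZR.
transitivity (\sum_(k < 6) a k * \int[P]_w f k w).
  by apply: eq_bigr => k _; rewrite RintegralZl//; exact: fi.
rewrite !big_ord_recr big_ord0 /a /f/= EL EC ELC EL2 -/(noise_risk A N).
by rewrite Rintegral_cstP /b; ring.
Qed.

Lemma diagEstE a c x N w :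
  diagEstN z n a c x N w = quadEstN z n (diag_of a) c x N w.
Proof.
rewrite /diagEstN /quadEstN; congr (_ + _); apply: eq_bigr => i _.
rewrite (bigD1 i)//= /diag_of eqxx big1 ?addr0 => [|j ji]; first by rewrite expr2 mulrA.
by rewrite eq_sym (negPf ji : (j == i :> nat) = false) !mul0r.
Qed.

End risk.

(** * Uniform boundedness over signs *)

Lemma limn_esup_inf {R : realType} (u : (\bar R)^nat) :
  limn_esup u = ereal_inf (range (esups u)).
Proof. by rewrite limn_esup_lim; apply/cvg_lim => //; exact: cvg_esups_inf. Qed.

(** With [limn_esup_lt], this trades a bound on the limit superior for eventual bounds by reals. [S]
    may be [+oo], and the sign condition excludes [-oo]. *)
Lemma limn_esup_le {R : realType} (u : nat -> R) (S : \bar R) : (0 <= S)%E ->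
  (forall r : R, (S < r%:E)%E -> exists M, forall N, (M <= N)%N -> u N <= r) ->
  (limn_esup (fun N => (u N)%:E) <= S)%E.
Proof.
case: S => [S| |]//; last by move=> *; rewrite leey.
move=> _ uS; apply/lee_addgt0Pr => e e0.
have [|M uM] := uS (S + e); first by rewrite lte_fin ltrDl.
rewrite limn_esup_inf.
apply: le_trans (ereal_inf_lbound _) _; first by exists M.
by apply: ge_ereal_sup => _ [N /= MN <-]; rewrite lee_fin uM.
Qed.

Lemma limn_esup_lt {R : realType} (u : nat -> R) (r : R) :
  (limn_esup (fun N => (u N)%:E) < r%:E)%E ->
  exists M, forall N, (M <= N)%N -> u N <= r.
Proof.
rewrite limn_esup_inf => /ereal_inf_lt[_ [M _ <-]].
move=> /ltW uM; exists M => N MN; rewrite -lee_fin (le_trans _ uM)//.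
by apply: ereal_sup_ubound; exists N.
Qed.

Lemma limn_esup_ge0 {R : realType} (u : nat -> R) : (forall N, 0 <= u N) ->
  (0 <= limn_esup (fun N => (u N)%:E))%E.
Proof.
move=> u0; rewrite leNgt; apply/negP => u_lt0.
have [r r0 ur] : exists2 r : R, r < 0 & (limn_esup (fun N => (u N)%:E) < r%:E)%E.
  case: (limn_esup _) u_lt0 => [r| |]//.
    by rewrite lte_fin => r0; exists (r / 2); rewrite ?lte_fin; lra.
  by move=> _; exists (-1); rewrite ?ltNyr// ltrN10.
by have [M /(_ M (leqnn _))] := limn_esup_lt ur; have := u0 M; lra.
Qed.

(* Baire category on the Cantor space [nat -> bool]. *)
Lemma uniform_prefix {R : realType} (f : nat -> (nat -> bool) -> R) (r : R) :
  (forall N eps eps', (forall i, (i < N)%N -> eps i = eps' i) -> f N eps = f N eps') ->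
  (forall eps, exists M, forall N, (M <= N)%N -> f N eps <= r) ->
  exists (eta : nat -> bool) (m M : nat), forall eps,
    (forall i, (i < m)%N -> eps i = eta i) ->
    forall N, (M <= N)%N -> f N eps <= r.
Proof.
move=> floc fr; apply: contrapT => nP.
(* A pair encodes the cylinder of sign vectors agreeing with [p.1] before [p.2]. If the claim fails,
   each cylinder contains a smaller one on which some [f N] with [p.2 <= N] exceeds [r]; [N < q.2]
   makes [f N] constant there. *)
have step (p : (nat -> bool) * nat) : exists q : (nat -> bool) * nat,
    [/\ (forall i, (i < p.2)%N -> q.1 i = p.1 i), (p.2 < q.2)%N &
        exists N, [/\ (p.2 <= N)%N, (N < q.2)%N & r < f N q.1]].
  apply: contrapT => nq; apply: nP; exists p.1, p.2, p.2 => eps epsE N pN.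
  rewrite leNgt; apply/negP => rf; apply: nq; exists (eps, N.+1); split => //.
  by exists N.
have [g gP] := choice step.
pose q k := iter k g ((fun=> false), 0%N).
have qS k : q k.+1 = g (q k) by [].
have q2 k : (k <= (q k).2)%N.
  elim: k => // k IH; rewrite qS; have [_ + _] := gP (q k).
  exact: leq_ltn_trans.
have q2mono k l : (k <= l)%N -> ((q k).2 <= (q l).2)%N.
  elim: l => [|l IH]; first by rewrite leqn0 => /eqP ->.
  rewrite leq_eqVlt => /predU1P[->//|]; rewrite ltnS => /IH /leq_trans; apply.
  by rewrite qS; have [_ /ltnW + _] := gP (q l).
have qagree k l i : (k <= l)%N -> (i < (q k).2)%N -> (q l).1 i = (q k).1 i.
  move=> kl ik; elim: l kl => [|l IH]; first by rewrite leqn0 => /eqP ->.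
  rewrite leq_eqVlt => /predU1P[->//|]; rewrite ltnS => kl; rewrite -IH//.
  rewrite qS; have [+ _ _] := gP (q l); apply.
  exact: leq_trans ik (q2mono _ _ kl).
(* The common point of the nested cylinders: coordinate [i] is settled at stage [i.+1], whose length
   exceeds [i]. *)
pose eps i := (q i.+1).1 i.
have epsE k i : (i < (q k).2)%N -> eps i = (q k).1 i.
  move=> ik; rewrite /eps; have [ki|ki] := leqP k i.+1; first exact: qagree.
  by rewrite -(qagree i.+1 k)// ?(ltnW ki)// q2.
have [M frM] := fr eps.
(* Stage [M] supplies an [N] beyond [M] with a value above [r], against [frM]. *)
have [_ _ [N [MN Nq]]] := gP (q M); rewrite -qS in Nq *.
rewrite -(floc N eps) => [|i iN]; last by apply: epsE; exact: ltn_trans Nq.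
by rewrite ltNge frM// (leq_trans (q2 M)).
Qed.

Section flip.
Context {R : realType}.
Variables (t : R) (K : nat -> R) (A : nat -> nat -> R) (c : R).
Hypotheses (t0 : 0 < t) (K0 : forall N, 0 <= K N).

Lemma eq_qrisk N (x y : nat -> R) :
  (forall i, (i < N)%N -> x i = y i) -> qrisk t K A c N x = qrisk t K A c N y.
Proof.
move=> xy; rewrite /qrisk /qbias /qslope /QN; congr (_ ^+ 2 + t * _ + _).
  congr (_ + _ - _ + _).
    by apply: eq_bigr => i _; apply: eq_bigr => j _; rewrite !xy.
  by apply: eq_bigr => i _; rewrite xy.
by apply: eq_bigr => i _; congr (_ ^+ 2); apply: eq_bigr => j _; rewrite xy.
Qed.

Lemma qrisk_ge0 N x : 0 <= qrisk t K A c N x.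
Proof.
rewrite /qrisk !addr_ge0 ?sqr_ge0// mulr_ge0 ?(ltW t0)// sumr_ge0// => i _.
exact: sqr_ge0.
Qed.

Lemma qbias_le N x C : qrisk t K A c N x <= C -> qbias t A c N x ^+ 2 <= C.
Proof.
apply: le_trans; rewrite /qrisk -addrA lerDl addr_ge0// mulr_ge0 ?(ltW t0)//.
by apply: sumr_ge0 => i _; exact: sqr_ge0.
Qed.

Lemma qslope_le N x C : qrisk t K A c N x <= C ->
  \sum_(i < N) qslope A N x i ^+ 2 <= C / t.
Proof.
rewrite ler_pdivlMr// mulrC; apply: le_trans; rewrite /qrisk.
by rewrite -addrA addrCA lerDl addr_ge0 ?sqr_ge0.
Qed.

Let shift (x : nat -> R) p u i := if i == p then x i + u else x i.

Lemma qslope_shift N x p u i : (p < N)%N ->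
  qslope A N (shift x p u) i = qslope A N x i + (A i p + A p i) * u.
Proof.
move=> pN; rewrite /qslope (bigD1 (Ordinal pN))//= [in RHS](bigD1 (Ordinal pN))//=.
rewrite /shift eqxx mulrDr -!addrA; congr (_ + _); rewrite addrC; congr (_ + _).
by apply: eq_bigr => j jp; rewrite (negPf jp : (j == p :> nat) = false).
Qed.

(** The second hypothesis says that the shift keeps [x p] up to sign, so the [QN] term is
    unchanged. *)
Lemma qbias_shift N x p u : (p < N)%N -> (x p + u) ^+ 2 = x p ^+ 2 ->
  qbias t A c N (shift x p u) = qbias t A c N x + (u * qslope A N x p + A p p * u ^+ 2).
Proof.
move=> pN xu; rewrite /qbias.
have -> : QN (shift x p u) N = QN x N.
  by apply: eq_bigr => i _; rewrite /shift; case: eqP => // ->.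
have lin (y : nat -> R) i : \sum_(j < N) A i j * y i * shift x p u j =
    \sum_(j < N) A i j * y i * x j + A i p * y i * u.
  rewrite (bigD1 (Ordinal pN))//= [in RHS](bigD1 (Ordinal pN))//=.
  rewrite /shift eqxx mulrDr -!addrA; congr (_ + _); rewrite addrC; congr (_ + _).
  by apply: eq_bigr => j jp; rewrite (negPf jp : (j == p :> nat) = false).
have -> : \sum_(i < N) \sum_(j < N) A i j * shift x p u i * shift x p u j =
    \sum_(i < N) \sum_(j < N) A i j * x i * x j +
    (u * qslope A N x p + A p p * u ^+ 2).
  under eq_bigr do rewrite lin.
  rewrite big_split/= (bigD1 (Ordinal pN))//= [X in _ + X = _](bigD1 (Ordinal pN))//=.
  rewrite [in RHS](bigD1 (Ordinal pN))//= /qslope.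
  under [X in _ + X + _ = _]eq_bigr => i ip.
    rewrite /shift (negPf ip : (i == p :> nat) = false); over.
  under [X in _ + (_ + X) = _]eq_bigr => i ip.
    rewrite /shift (negPf ip : (i == p :> nat) = false); over.
  have -> : \sum_(j < N) (A p j + A j p) * x j =
      \sum_(j < N) A p j * x j + (A p p * x p +
      \sum_(j < N | j != Ordinal pN) A j p * x j).
    transitivity (\sum_(j < N) A p j * x j + \sum_(j < N) A j p * x j).
      by rewrite -big_split; apply: eq_bigr => j _; rewrite mulrDl.
    by rewrite [X in _ + X = _](bigD1 (Ordinal pN)).
  rewrite /shift eqxx.
  have -> : \sum_(j < N) A p j * (x p + u) * x j =
      \sum_(j < N) A p j * x p * x j + u * \sum_(j < N) A p j * x j.
    by rewrite mulr_sumr -big_split; apply: eq_bigr => j _ /=; ring.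
  rewrite -[X in _ + (_ + X) = _]mulr_suml; ring.
ring.
Qed.

Variable th : nat -> R.
Let sgn (eps : nat -> bool) i := if eps i then - th i else th i.
Let F N eps := qrisk t K A c N (sgn eps).

Let flip p (eps : nat -> bool) i := if i == p then ~~ eps i else eps i.

Let sgn_flip p eps : sgn (flip p eps) = shift (sgn eps) p (- 2 * sgn eps p).
Proof.
apply/funext => i; rewrite /sgn /flip /shift; case: eqP => // ->.
by case: (eps p) => /=; ring.
Qed.

Let sgn_sqr p eps : sgn eps p ^+ 2 = th p ^+ 2.
Proof. by rewrite /sgn; case: ifP; rewrite ?sqrrN. Qed.

(** Releases the sign at [p]. A vector that disagrees with [eta] there is the flip of one in the
    controlled cylinder. The flip changes the bias through the slope at [p] and the fixed number
    [A p p], and the slopes through the [p]-th row and column of [A], all bounded uniformly. *)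
Let bounded_flip (r : R) p eta C M :
  (forall eps, exists M, forall N, (M <= N)%N -> F N eps <= r) ->
  (forall eps, (forall i, (i < p.+1)%N -> eps i = eta i) ->
     forall N, (M <= N)%N -> F N eps <= C) ->
  exists C M, (forall eps, (forall i, (i < p)%N -> eps i = eta i) ->
     forall N, (M <= N)%N -> F N eps <= C).
Proof.
move=> Fr FC.
have [M1 FM1] := Fr eta; have [M2 FM2] := Fr (flip p eta).
pose u2 := 4 * th p ^+ 2.
have u2_ge0 : 0 <= u2 by rewrite mulr_ge0 ?sqr_ge0.
have uE eps : (- 2 * sgn eps p) ^+ 2 = u2 by rewrite exprMn sgn_sqr /u2; ring.
(* Comparing [eta] with its flip at [p] bounds the [p]-th column of [A]. *)
have colD N : (maxn p.+1 (maxn M1 M2) <= N)%N ->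
    \sum_(i < N) (A i p + A p i) ^+ 2 * u2 <= 4 * (r / t).
  rewrite !geq_max => /and3P[pN M1N M2N].
  have S1 := qslope_le (FM1 _ M1N); have S2 := qslope_le (FM2 _ M2N).
  apply: (@le_trans _ _ (2 * (\sum_(i < N) qslope A N (sgn eta) i ^+ 2 +
     \sum_(i < N) qslope A N (sgn (flip p eta)) i ^+ 2))); last by lra.
  rewrite -big_split mulr_sumr; apply: ler_sum => i _ /=.
  rewrite sgn_flip qslope_shift// -(uE eta) -exprMn.
  set a := qslope _ _ _ _; set b := _ * (- 2 * _).
  by have := sqr_ge0 (2 * a + b); nra.
(* In order: the squared bias, the slopes and the noise part of the flipped vector, each squared sum
   being split by [(x + y) ^+ 2 <= 2 * x ^+ 2 + 2 * y ^+ 2]. *)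
pose B := 2 * C + 2 * (2 * u2 * (C / t) + 2 * A p p ^+ 2 * u2 ^+ 2) +
          t * (2 * (C / t) + 2 * (4 * (r / t))) + C.
exists (Num.max C B), (maxn M (maxn p.+1 (maxn M1 M2))) => eps epsE N.
rewrite geq_max => /andP[MN MNs]; rewrite le_max.
have [/eqP epE|epN] := boolP (eps p == eta p).
  rewrite FC// => i; rewrite ltnS leq_eqVlt => /predU1P[->//|]; exact: epsE.
apply/orP; right.
have pN : (p < N)%N by move: MNs; rewrite geq_max => /andP[].
pose e1 := flip p eps.
have e1C : F N e1 <= C.
  apply: FC => // i; rewrite ltnS leq_eqVlt /e1 /flip => /predU1P[->|ip].
    by rewrite eqxx; case: (eps p) epN; case: (eta p).
  by rewrite (ltn_eqF ip) epsE.
have epsF : eps = flip p e1.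
  by apply/funext => i; rewrite /e1 /flip; case: eqP => // _; rewrite negbK.
have := qbias_le e1C; have S1 := qslope_le e1C => b1.
have Sp : qslope A N (sgn e1) p ^+ 2 <= C / t.
  apply: le_trans S1; rewrite (bigD1 (Ordinal pN))//= lerDl sumr_ge0// => i _.
  exact: sqr_ge0.
have KC : K N <= C.
  apply: le_trans e1C; rewrite /F /qrisk lerDr addr_ge0 ?sqr_ge0// mulr_ge0 ?(ltW t0)//.
  by apply: sumr_ge0 => i _; exact: sqr_ge0.
have u1 := uE e1; set u := - 2 * sgn e1 p in u1.
have xu : (sgn e1 p + u) ^+ 2 = sgn e1 p ^+ 2 by rewrite /u; ring.
rewrite /F epsF sgn_flip -/u /qrisk qbias_shift//.
under eq_bigr do rewrite qslope_shift//.
rewrite /B lerD// lerD//.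
- set b := qbias _ _ _ _ _ in b1 *; set sl := qslope _ _ _ _ in Sp *.
  have h1 : (b + (u * sl + A p p * u ^+ 2)) ^+ 2 <=
     2 * b ^+ 2 + 2 * (2 * (u ^+ 2 * sl ^+ 2) + 2 * (A p p ^+ 2 * (u ^+ 2) ^+ 2)).
    have := sqr_ge0 (b - (u * sl + A p p * u ^+ 2)).
    by have := sqr_ge0 (u * sl - A p p * u ^+ 2); nra.
  apply: (le_trans h1); rewrite u1.
  have : u2 * sl ^+ 2 <= u2 * (C / t) by rewrite ler_wpM2l.
  by lra.
- rewrite ler_wpM2l ?(ltW t0)//.
  have cD := colD N MNs.
  apply: (@le_trans _ _ (2 * (\sum_(i < N) qslope A N (sgn e1) i ^+ 2) +
      2 * \sum_(i < N) (A i p + A p i) ^+ 2 * u2)); last by lra.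
  rewrite !mulr_sumr -big_split; apply: ler_sum => i _ /=.
  rewrite -u1 -exprMn; set a := qslope _ _ _ _; set b := _ * u.
  by have := sqr_ge0 (a - b); nra.
Qed.

Lemma qrisk_uniform_bound (r : R) :
  (forall eps : nat -> bool, exists M, forall N, (M <= N)%N ->
     qrisk t K A c N (fun i => if eps i then - th i else th i) <= r) ->
  exists C M, forall (eps : nat -> bool) N, (M <= N)%N ->
     qrisk t K A c N (fun i => if eps i then - th i else th i) <= C.
Proof.
move=> Fr.
have [|eta [m [M FM]]] := @uniform_prefix _ F r _ Fr.
  by move=> N eps eps' e; apply: eq_qrisk => i iN; rewrite /sgn e.
have {FM} : exists C M, (forall eps, (forall i, (i < m)%N -> eps i = eta i) ->
     forall N, (M <= N)%N -> F N eps <= C) by exists r, M.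
(* The last fixed sign is released first; the bound and the threshold may grow at each of the [m]
   releases. *)
elim: m => [[C [M' FC]]|m IH [C [M' FC]]].
  by exists C, M' => eps N; apply: FC.
by apply: IH; exact: bounded_flip Fr FC.
Qed.

End flip.

(** * Averaging over signs *)

Section sign_average.
Context {R : realType} {d : measure_display} {T : measurableType d}.
Context {P : probability T R}.
Variable z : nat -> {RV P >-> R}.
Hypothesis iid_z : iid_std_normal z.
Variables (t : R) (K K' : nat -> R) (A : nat -> nat -> R) (c : R) (th : nat -> R).
Hypotheses (t0 : 0 < t) (K0 : forall N, 0 <= K N) (KK' : forall N, K' N <= K N).
Local Notation intg f := (P.-integrable setT (fun w => (f w)%:E)).

(** The signs of the noise serve as independent fair signs on the given probability space. *)
Let s i w : R := sgnb (z i w).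

Let sE i w : s i w = 1 \/ s i w = -1.
Proof. by rewrite /s /sgnb; case: ifP; [right|left]. Qed.

Let ss i w : s i w * s i w = 1.
Proof. by case: (sE i w) => ->; rewrite ?mulr1 ?mulrNN ?mulr1. Qed.

Let ms i : measurable_fun setT (s i).
Proof. by have /integrableP[/measurable_EFinP] := integrable_sgnb (z i). Qed.

Let sq_integrable_s i : sq_integrable (P := P) (s i).
Proof.
split=> //; under eq_fun do rewrite expr2 ss.
exact: (finite_measure_integrable_cst _ 1).
Qed.

Let sq_integrable_s2 i j : sq_integrable (P := P) (fun w => s i w * s j w).
Proof.
split; first exact: measurable_funM.
under eq_fun do rewrite exprMn !expr2 !ss mulr1.
exact: (finite_measure_integrable_cst _ 1).
Qed.

Let Rintegral_s2 i j : \int[P]_w (s i w * s j w) = if i == j then 1 else 0.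
Proof.
case: eqVneq => [<-|ij].
  by under eq_RintegralT do rewrite ss; rewrite Rintegral_cstP.
have uij : uniq [:: i; j] by rewrite /= inE ij.
transitivity (\int[P]_w \prod_(k <- [:: i; j]) sgnb (z k w)).
  by apply: eq_RintegralT => w; rewrite big_cons big_seq1.
rewrite (Rintegral_prod_indep (z := z) iid_z.2 (h := fun=> sgnb) uij).
- by rewrite big_cons Rintegral_sgnb ?mul0r//; exact: iid_z.1.
- move=> _; apply: measurable_fun_ifT => //.
  exact: measurable_fun_ltr.
- by move=> k; exact: integrable_sgnb.
Qed.

Let x w i := s i w * th i.
Let G N w := qrisk t K A c N (x w).

Let bias N w := qbias t A c N (x w).

Let biasE N w : bias N w =
  \sum_(ij : 'I_N * 'I_N) (A ij.1 ij.2 * th ij.1 * th ij.2) * (s ij.1 w * s ij.2 w) +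
  (c - QN th N + t * \sum_(i < N) A i i).
Proof.
rewrite /bias /qbias !addrA; congr (_ + _ - _ + _).
  rewrite (pair_bigA _ (fun i j : 'I_N => A i j * x w i * x w j))/=.
  by apply: eq_bigr => ij _; rewrite /x; ring.
by apply: eq_bigr => i _; rewrite /x exprMn expr2 ss mul1r.
Qed.

Let sq_integrable_bias N : sq_integrable (P := P) (bias N).
Proof.
have -> := funext (biasE N).
apply: sq_integrableD; last exact: sq_integrable_cst.
by apply: sq_integrable_sum => ij; apply: sq_integrableZ; exact: sq_integrable_s2.
Qed.

Let D := diag_of (fun i => A i i).

Let diag_sum N (f : 'I_N -> R) (i : 'I_N) :
  \sum_(j < N) D i j * f j = A i i * f i.
Proof.
rewrite (bigD1 i)//= /D /diag_of eqxx big1 ?addr0// => j ji.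
by rewrite eq_sym (negPf ji : (j == i :> nat) = false) mul0r.
Qed.

(** The signs are orthonormal, so the off-diagonal terms average out. *)
Let Rintegral_bias N : \int[P]_w bias N w = qbias t D c N th.
Proof.
under eq_RintegralT do rewrite biasE.
rewrite RintegralD//; last 2 first.
- apply: sq_integrable_intg; apply: sq_integrable_sum => ij; apply: sq_integrableZ.
  exact: sq_integrable_s2.
- exact/sq_integrable_intg/sq_integrable_cst.
rewrite Rintegral_cstP Rintegral_lin; last by move=> ij; exact: sq_integrable_s2.
rewrite /qbias !addrA; congr (_ + _ - _ + _ * _).
  rewrite -(pair_bigA _ (fun i j : 'I_N => (A i j * th i * th j) * \int[P]_w (s i w * s j w)))/=.
  apply: eq_bigr => i _; apply: eq_bigr => j _; rewrite Rintegral_s2 /D /diag_of.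
  by case: eqP => [->|]; rewrite ?mulr1 ?mulr0 ?mul0r.
by apply: eq_bigr => i _; rewrite /D /diag_of eqxx.
Qed.

Let slopeE N i w : qslope A N (x w) i = \sum_(j < N) ((A i j + A j i) * th j) * s j w.
Proof. by apply: eq_bigr => j _; rewrite /x; ring. Qed.

Let sq_integrable_slope N i : sq_integrable (P := P) (fun w => qslope A N (x w) i).
Proof.
under eq_fun do rewrite slopeE.
by apply: sq_integrable_sum => j; exact: sq_integrableZ.
Qed.

Let integrable_G N : intg (G N).
Proof.
apply: integrableDR; last exact: (finite_measure_integrable_cst _ (K N)).
apply: integrableDR; first by case: (sq_integrable_bias N).
by apply: integrableZR; apply: integrable_sumR => i; case: (sq_integrable_slope N i).
Qed.

(** The three summands are compared separately: Jensen for the bias, orthonormality of the signs for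
    the slopes, [KK'] for the noise. *)
Let diag_le_average N : qrisk t K' D c N th <= \int[P]_w G N w.
Proof.
have ib := (sq_integrable_bias N).2.
have islope i := (sq_integrable_slope N i).2.
rewrite /G /qrisk RintegralD//; last 2 first.
- apply: integrableDR => //; apply: integrableZR; exact: integrable_sumR.
- exact: (finite_measure_integrable_cst _ (K N)).
rewrite Rintegral_cstP lerD// RintegralD//; last first.
  by apply: integrableZR; exact: integrable_sumR.
rewrite RintegralZl//; last exact: integrable_sumR.
apply: lerD.
  set m := qbias _ _ _ _ _.
  (* Jensen in the form of a nonnegative variance, [m] being the mean of [bias N]. *)
  have : 0 <= \int[P]_w ((bias N w - m) ^+ 2) by apply: Rintegral_ge0 => w _; exact: sqr_ge0.
  have -> : \int[P]_w ((bias N w - m) ^+ 2) =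
      \int[P]_w (bias N w ^+ 2 + ((- 2 * m) * bias N w + m ^+ 2)).
    by apply: eq_RintegralT => w; ring.
  have ib1 := sq_integrable_intg (sq_integrable_bias N).
  have ic := sq_integrable_intg (sq_integrable_cst (P := P) (m ^+ 2)).
  rewrite RintegralD//; last by apply: integrableDR => //; exact: integrableZR.
  rewrite RintegralD//; last exact: integrableZR.
  rewrite RintegralZl// Rintegral_cstP Rintegral_bias -/m.
  by rewrite /bias; lra.
rewrite ler_wpM2l ?(ltW t0)// Rintegral_sum//; apply: ler_sum => i _.
under eq_RintegralT do rewrite slopeE.
rewrite (@Rintegral_sqr_orthogonal _ _ _ _ _ _ _ 1)// mul1r.
have -> : qslope D N th i = (A i i + A i i) * th i.
  transitivity (\sum_(j < N) D i j * (2 * th j)).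
    apply: eq_bigr => j _; rewrite /D /diag_of [j == i :> nat]eq_sym.
    by case: eqP => [->|_]; ring.
  by rewrite (diag_sum (fun j => 2 * th j)); ring.
(* Of the mean squared slope only the term [j = i] is kept; it is the squared slope of the diagonal
   part. *)
by rewrite (bigD1 i)//= lerDl sumr_ge0// => j _; exact: sqr_ge0.
Qed.

(** The excess of the risk over [r] tends to [0] for each sign vector and is uniformly bounded, so
    by dominated convergence its mean is eventually below [e]. *)
Lemma diag_le_signs (r e : R) : 0 < e ->
  (forall eps : nat -> bool, exists M, forall N, (M <= N)%N ->
     qrisk t K A c N (fun i => if eps i then - th i else th i) <= r) ->
  exists M, forall N, (M <= N)%N -> qrisk t K' D c N th <= r + e.
Proof.
move=> e0 Fr.
have xE w : x w = fun i => if z i w < 0 then - th i else th i.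
  by apply/funext => i; rewrite /x /s /sgnb; case: ifP => _; rewrite ?mulN1r ?mul1r.
have [C [M FC]] := qrisk_uniform_bound t0 K0 Fr.
have GC N w : (M <= N)%N -> G N w <= C by move=> MN; rewrite /G xE FC.
(* The shift by [M] makes the uniform bound [C] available from index [0] on. *)
pose g N w := Num.max (G (M + N)%N w - r) 0.
have mG N : measurable_fun setT (G N).
  by have /integrableP[/measurable_EFinP] := integrable_G N.
have mg N : measurable_fun setT (g N).
  by apply: measurable_maxr => //; apply: measurable_funB.
have gB N w : `|g N w| <= `|C| + `|r|.
  rewrite ger0_norm ?le_max ?lexx ?orbT// /g ge_max addr_ge0// andbT.
  have := GC _ w (leq_addr N M); have := ler_norm C.
  by have := ler_norm (- r); rewrite normrN; lra.
have g0 w : (g N w)%:E @[N --> \oo] --> 0%E.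
  (* At a fixed [w] the random signs form one sign vector, to which the hypothesis applies. *)
  have [M' rM'] := Fr (fun i => z i w < 0).
  apply: cvg_near_cst; exists M' => // N /= M'N; congr EFin.
  apply: max_r; rewrite subr_le0 /G xE; apply: rM'.
  exact: leq_trans (leq_addl _ _).
have [] := @dominated_convergence _ T R P setT measurableT
  (fun N w => (g N w)%:E) (fun=> 0%E) (fun=> (`|C| + `|r|)%:E).
- by move=> N; exact/measurable_EFinP.
- by [].
- by apply: aeW => w _; exact: g0.
- exact: (finite_measure_integrable_cst _ (`|C| + `|r|)).
- by apply: aeW => w N _; rewrite lee_fin gB.
move=> _ _; rewrite integral0 => gcv.
have ig N : intg (g N).
  apply: (@le_integrable _ _ _ _ _ measurableT _ (fun=> (`|C| + `|r|)%:E)).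
  - exact/measurable_EFinP.
  - by move=> w _; rewrite lee_fin (le_trans (gB N w))// ler_norm.
  - exact: (finite_measure_integrable_cst _ (`|C| + `|r|)).
have /fine_cvgP[_ /cvgrPdist_lt/(_ e e0)[M2 _ gM2]] := gcv.
exists (M + M2)%N => N MN; have MN' : (M <= N)%N by exact: leq_trans (leq_addr _ _) MN.
apply: (le_trans (diag_le_average N)).
have NE : N = (M + (N - M))%N by rewrite subnKC.
have := gM2 (N - M)%N; rewrite /= leq_subRL// => /(_ MN).
rewrite sub0r normrN -/(Rintegral _ _ _) => /ltr_normlW ge.
apply: (@le_trans _ _ (\int[P]_w (g (N - M)%N w + r))).
  apply: le_Rintegral => //.
  - exact: integrable_G.
  - apply: integrableDR; first exact: ig.
    exact: (finite_measure_integrable_cst _ r).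
  - by move=> w _; rewrite /g -NE -lerBlDr le_max lexx.
rewrite RintegralD//; last 2 first.
- exact: ig.
- exact: (finite_measure_integrable_cst _ r).
by rewrite Rintegral_cstP addrC lerD2l ltW.
Qed.

End sign_average.

(** * Convexity of the diagonal risk *)

Section diagonal_convexity.
Context {R : realType}.
Variables (t : R) (K : nat -> R) (a : nat -> R) (c : R).

(** For a diagonal matrix the bias is affine in the squares [x i ^+ 2], and the slope
    [2 * a i * x i] accounts for the factor [4]. *)
Lemma qrisk_diag N x : qrisk t K (diag_of a) c N x =
  (\sum_(i < N) (a i - 1) * x i ^+ 2 + (c + t * \sum_(i < N) a i)) ^+ 2 +
  4 * t * (\sum_(i < N) a i ^+ 2 * x i ^+ 2) + K N.
Proof.
have dE (f : 'I_N -> R) (i : 'I_N) : \sum_(j < N) diag_of a i j * f j = a i * f i.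
  rewrite (bigD1 i)//= /diag_of eqxx big1 ?addr0// => j ji.
  by rewrite eq_sym (negPf ji : (j == i :> nat) = false) mul0r.
rewrite /qrisk /qbias /qslope; congr (_ ^+ 2 + _ + _).
  have -> : \sum_(i < N) diag_of a i i = \sum_(i < N) a i.
    by apply: eq_bigr => i _; rewrite /diag_of eqxx.
  have -> : \sum_(i < N) \sum_(j < N) diag_of a i j * x i * x j =
      \sum_(i < N) (a i - 1) * x i ^+ 2 + QN x N.
    rewrite /QN -big_split; apply: eq_bigr => i _ /=.
    under eq_bigr do rewrite -mulrA.
    by rewrite (dE (fun j => x i * x j)); ring.
  by ring.
rewrite [4 * t]mulrC -mulrA; congr (_ * _); rewrite mulr_sumr.
apply: eq_bigr => i _.
transitivity ((2 * (a i * x i)) ^+ 2); last by ring.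
congr (_ ^+ 2); rewrite -(dE (fun j => x j)) mulr_sumr; apply: eq_bigr => j _.
rewrite /diag_of [j == i :> nat]eq_sym; case: eqP => [->|_]; ring.
Qed.

(** In terms of the squared coordinates the risk is the square of an affine function plus an affine
    one, hence convex. *)
Lemma qrisk_diag_convex N (k : nat) (lam : 'I_k -> R) (th : 'I_k -> nat -> R)
    (x : nat -> R) (r : R) :
  (forall j, 0 <= lam j) -> \sum_j lam j = 1 ->
  (forall i, x i ^+ 2 = \sum_j lam j * th j i ^+ 2) ->
  (forall j, qrisk t K (diag_of a) c N (th j) <= r) ->
  qrisk t K (diag_of a) c N x <= r.
Proof.
move=> lam0 lam1 xE thr.
apply: (@le_trans _ _ (\sum_j lam j * qrisk t K (diag_of a) c N (th j))); last first.
  rewrite -[leRHS]mul1r -lam1 mulr_suml; apply: ler_sum => j _.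
  by rewrite ler_wpM2l.
pose q := c + t * \sum_(i < N) a i.
pose b j := \sum_(i < N) (a i - 1) * th j i ^+ 2 + q.
pose m := \sum_j lam j * b j.
have swap (f : nat -> R) : \sum_(i < N) f i * x i ^+ 2 =
    \sum_j lam j * \sum_(i < N) f i * th j i ^+ 2.
  under [RHS]eq_bigr do rewrite mulr_sumr.
  rewrite exchange_big/=; apply: eq_bigr => i _; rewrite xE mulr_sumr.
  by apply: eq_bigr => j _; rewrite mulrCA.
have mE : \sum_(i < N) (a i - 1) * x i ^+ 2 + q = m.
  rewrite (swap (fun i => a i - 1)) /m /b.
  under [RHS]eq_bigr do rewrite mulrDr.
  by rewrite big_split/= -mulr_suml lam1 mul1r.
have jensen : m ^+ 2 <= \sum_j lam j * b j ^+ 2.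
  have : 0 <= \sum_j lam j * (b j - m) ^+ 2.
    by apply: sumr_ge0 => j _; rewrite mulr_ge0 ?sqr_ge0.
  have -> : \sum_j lam j * (b j - m) ^+ 2 =
      \sum_j (lam j * b j ^+ 2 + (- 2 * m) * (lam j * b j) + m ^+ 2 * lam j).
    by apply: eq_bigr => j _; ring.
  by rewrite !big_split/= -!mulr_sumr lam1 -/m; lra.
rewrite qrisk_diag -/q mE (swap (fun i => a i ^+ 2)).
have -> : \sum_j lam j * qrisk t K (diag_of a) c N (th j) =
    \sum_j lam j * b j ^+ 2 +
    4 * t * (\sum_j lam j * \sum_(i < N) a i ^+ 2 * th j i ^+ 2) + K N.
  have KE : K N = \sum_j lam j * K N by rewrite -mulr_suml lam1 mul1r.
  rewrite [X in _ = _ + X]KE mulr_sumr -!big_split/=.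
  by apply: eq_bigr => j _; rewrite qrisk_diag -/q -/(b j); ring.
by rewrite lerD2r lerD2r.
Qed.

End diagonal_convexity.

(** * The quadratic hull and the minimax risks *)

Lemma orthosymmetric_sub_QHull {R : realType} (Th : set (nat -> R)) :
  orthosymmetric Th -> Th `<=` QHull Th.
Proof.
move=> oTh th Tht.
exists 1%N, (fun=> 1), (fun=> (fun i => th i ^+ 2)); split; first by [].
split; first by rewrite big_ord1.
split; last by apply/funext => i; rewrite big_ord1 mul1r.
(* [Theta_plus_sq] admits nonnegative sequences only; orthosymmetry provides the sequence of
   absolute values. *)
move=> _; exists (fun i => if th i < 0 then - th i else th i); split.
  exact: (oTh _ Tht (fun i => th i < 0)).
split; first by move=> i; case: ltP => //; rewrite oppr_ge0; exact: ltW.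
by apply/funext => i; case: ifP => _; rewrite ?sqrrN.
Qed.

Theorem theorem1 (R : realType) (d : measure_display) (T : measurableType d)
    (P : probability T R) (z : nat -> {RV P >-> R}) (n : nat)
    (Th : set (nat -> R)) :
  iid_std_normal z -> (0 < n)%N -> orthosymmetric Th ->
  (forall (a : nat -> R) (c : R),
      ereal_sup [set mse P (diagEstN z n a c th) th | th in Th] =
      ereal_sup [set mse P (diagEstN z n a c th) th | th in QHull Th]) /\
  RQstar z n Th = RQstar z n (QHull Th) /\
  RQstar z n (QHull Th) = RDQstar z n (QHull Th).
Proof.
move=> iid_z n0 oTh.
pose s : R := (Num.sqrt n%:R)^-1; pose t := s ^+ 2 * noise_var z.
pose K A N := s ^+ 4 * noise_risk z A N.
have s0 : 0 < s by rewrite invr_gt0 sqrtr_gt0 ltr0n.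
have t0 : 0 < t by rewrite mulr_gt0 ?exprn_gt0// noise_var_gt0.
have K0 A N : 0 <= K A N by rewrite mulr_ge0 ?noise_risk_ge0// exprn_ge0// ltW.
have mseQ A c th : mse P (quadEstN z n A c th) th =
    limn_esup (fun N => (qrisk t (K A) A c N th)%:E).
  by congr limn_esup; apply/funext => N; exact: quadEst_risk.
have diagE a c th : diagEstN z n a c th = quadEstN z n (diag_of a) c th.
  by apply/funext => N; apply/funext => w; exact: diagEstE.
have mseQ_ge0 A c th : (0 <= mse P (quadEstN z n A c th) th)%E.
  by rewrite mseQ; apply: limn_esup_ge0 => N; exact: qrisk_ge0.
have Th_hull := orthosymmetric_sub_QHull oTh.
have hullE a c : ereal_sup [set mse P (diagEstN z n a c th) th | th in Th] =
    ereal_sup [set mse P (diagEstN z n a c th) th | th in QHull Th].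
  apply/eqP; rewrite eq_le; apply/andP; split.
    by apply: ereal_sup_le; exact: image_subset.
  apply: ge_ereal_sup => _ [x [k [lam [p [lam0 [lam1 [pTh xE]]]]]] <-].
  have /choice[th thP] : forall j, exists y, Th y /\ p j = (fun i => y i ^+ 2).
    by move=> j; have [y [Ty [_ yE]]] := pTh j; exists y.
  set S := ereal_sup _.
  have thS j : (mse P (quadEstN z n (diag_of a) c (th j)) (th j) <= S)%E.
    by apply: ereal_sup_ubound; exists (th j); [exact: (thP j).1|rewrite diagE].
  rewrite diagE mseQ; apply: limn_esup_le => [|r Sr].
    (* Weights summing to [1] exclude [k = 0]; any one of the points then gives [0 <= S]. *)
    case: k lam p lam0 lam1 pTh xE th thP thS => [lam p _|k lam p _ _ _ _ th _ thS].
      by rewrite big_ord0 => /eqP; rewrite eq_sym oner_eq0.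
    exact: le_trans (thS ord0).
  have /choice[M MP] : forall j, exists M, forall N, (M <= N)%N ->
      qrisk t (K (diag_of a)) (diag_of a) c N (th j) <= r.
    by move=> j; apply: limn_esup_lt; rewrite -mseQ (le_lt_trans (thS j)).
  (* A convex combination has finitely many points, so one threshold serves all of them. *)
  exists (\max_j M j) => N MN.
  apply: (qrisk_diag_convex lam0 lam1) => [i|j].
    rewrite -[LHS]/((fun i => x i ^+ 2) i) xE.
    by apply: eq_bigr => j _; rewrite (thP j).2.
  by apply: MP; apply: leq_trans MN; exact: leq_bigmax.
(* Discarding the off-diagonal coefficients does not increase the maximal risk, because every sign
   change of [th] stays in [Th]. *)
have quad_diag A c : (maxrisk_diag z n (fun i => A i i) c Th <= maxrisk_quad z n A c Th)%E.
  apply: ge_ereal_sup => _ [th Tht <-]; rewrite diagE.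
  have signS eps : (limn_esup (fun N => (qrisk t (K A) A c N
      (fun i => if eps i then - th i else th i))%:E) <= maxrisk_quad z n A c Th)%E.
    rewrite -mseQ; apply: ereal_sup_ubound.
    by exists (fun i => if eps i then - th i else th i) => //; exact: oTh.
  have S0 : (0 <= maxrisk_quad z n A c Th)%E.
    apply: le_trans (signS (fun=> false)); rewrite -mseQ; exact: mseQ_ge0.
  rewrite mseQ; apply: limn_esup_le => // r.
  (* The value [+oo] contradicts being below [r], and [-oo] contradicts [S0]. *)
  case: (maxrisk_quad _ _ _ _ _) S0 signS => [S S0 signS|//|//].
  rewrite lte_fin => Sr.
  have KD N : K (diag_of (fun i => A i i)) N <= K A N.
    by rewrite ler_wpM2l ?exprn_ge0 ?(ltW s0)// noise_risk_diag.
  (* The midpoint of [S] and [r] lies strictly above every limit superior, and the other half of the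
     gap is the slack. *)
  have [||M MP] := @diag_le_signs _ _ _ _ _ iid_z t (K A) (K (diag_of (fun i => A i i)))
    A c th t0 (K0 A) KD ((S + r) / 2) ((r - S) / 2).
  - by lra.
  - move=> eps; apply: limn_esup_lt; apply: le_lt_trans (signS eps) _.
    by rewrite lte_fin; lra.
  - by exists M => N /MP /le_trans; apply; lra.
(* The three inequalities [le1], [le2] and [le3] form a cycle, which forces equality throughout. *)
have le1 : (RQstar z n Th <= RQstar z n (QHull Th))%E.
  apply: le_ereal_inf_tmp => _ [A [c ->]].
  apply: le_trans (ereal_inf_lbound _) _; first by exists A, c.
  by apply: ereal_sup_le; exact: image_subset.
have le2 : (RQstar z n (QHull Th) <= RDQstar z n (QHull Th))%E.
  apply: le_ereal_inf_tmp => _ [a [c ->]].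
  apply: ereal_inf_lbound; exists (diag_of a), c.
  by rewrite /maxrisk_diag /maxrisk_quad; under eq_imagel do rewrite diagE.
have le3 : (RDQstar z n (QHull Th) <= RQstar z n Th)%E.
  apply: le_ereal_inf_tmp => _ [A [c ->]].
  apply: le_trans (quad_diag A c); rewrite /maxrisk_diag hullE.
  by apply: ereal_inf_lbound; exists (fun i => A i i), c.
split=> //; split; apply/eqP; rewrite eq_le.
- by rewrite le1 (le_trans le2).
- by rewrite le2 (le_trans le3).
Qed.
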